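(* Let $d\ge1$, let $\phi\in\mathbb{R}^{d+1}$ with $\|\phi\|<1$, and let $Y\sim C_d^*(\phi)$ with density $f(\cdot)=f(\cdot\,;\phi)$. Then the Fisher information matrix is $$\mathcal{I}=-E\left\{\frac{\partial^2}{\partial\phi\,\partial\phi^T}\log f(Y;\phi)\right\}=\frac{4}{(1-\|\phi\|^2)^2}\,\frac{d^2}{d+1}\,I,$$ where $I$ is the $(d+1)\times(d+1)$ identity matrix.
   Context: $S^d=\{x\in\mathbb{R}^{d+1}:\|x\|=1\}$. $C_d^*(\phi)$ is the spherical Cauchy distribution on $S^d$, with density with respect to surface area $$f(y;\phi)=\frac{\Gamma\{(d+1)/2\}}{2\pi^{(d+1)/2}}\left(\frac{|1-\|\phi\|^2|}{\|y-\phi\|^2}\right)^d,\quad y\in S^d.$$ *)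

(* Defs.v *)
From HB Require Import structures.
From mathcomp Require Import all_boot all_order all_algebra.
From mathcomp Require Import all_classical all_reals all_analysis.
From mathcomp Require Import measurable_realfun.

Set Implicit Arguments.
Unset Strict Implicit.
Unset Printing Implicit Defensive.

Import Order.TTheory GRing.Theory Num.Theory.
Import numFieldNormedType.Exports.

Local Open Scope classical_set_scope.
Local Open Scope ring_scope.

(* R^n is 'rV[R]_n.  The library puts no sigma-algebra on matrices; row vectors
   get the one generated by the coordinates, as the library does for tuples.
   For T = R this is the Borel sigma-algebra of R^n. *)
Definition measure_rV_display : measure_display -> measure_display.
Proof. exact. Qed.

Section measurable_rV.
Context {d} {T : measurableType d}.
Variable n : nat.

Let coors : 'I_n -> 'rV[T]_n -> T := fun i x => x ord0 i.

Let rV_set0 : g_sigma_preimage coors set0.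
Proof. exact: sigma_algebra0. Qed.

Let rV_setC A : g_sigma_preimage coors A -> g_sigma_preimage coors (~` A).
Proof. exact: sigma_algebraC. Qed.

Let rV_bigcup (F : _^nat) : (forall i, g_sigma_preimage coors (F i)) ->
  g_sigma_preimage coors (\bigcup_i (F i)).
Proof. exact: sigma_algebra_bigcup. Qed.

HB.instance Definition _ := @isMeasurable.Build (measure_rV_display d)
  'rV[T]_n (g_sigma_preimage coors) rV_set0 rV_setC rV_bigcup.

End measurable_rV.

Lemma measurable_rV_coord d (T : measurableType d) n (i : 'I_n) :
  measurable_fun [set: 'rV[T]_n] (fun x => x ord0 i).
Proof.
move=> _ Y mY; rewrite setTI; apply: sub_sigma_algebra => /=.
rewrite -bigcup_seq/=; exists i => /=; first by rewrite mem_index_enum.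
by exists Y => //; rewrite setTI.
Qed.

Lemma measurable_fun_rVP d1 d2 (T1 : measurableType d1) (T2 : measurableType d2)
    n (f : T1 -> 'rV[T2]_n) :
  measurable_fun [set: T1] f <->
  forall i, measurable_fun [set: T1] (fun x => f x ord0 i).
Proof.
split=> [mf i|mf].
  exact: (measurableT_comp (measurable_rV_coord i) mf).
apply: (@measurability _ _ _ _ setT f _ erefl) => A [B sB <-].
move: sB; rewrite -bigcup_seq => -[i _ [C mC <-]].
by have := mf i measurableT _ mC; rewrite !setTI.
Qed.

Section lebesgue_rV.
Context {R : realType}.

Definition cons_rV n (p : measurableTypeR R * 'rV[R]_n) : 'rV[R]_n.+1 :=
  \row_i oapp (p.2 ord0) p.1 (unlift ord0 i).

Definition uncons_rV n (x : 'rV[R]_n.+1) : measurableTypeR R * 'rV[R]_n :=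
  (x ord0 ord0, \row_i x ord0 (lift ord0 i)).

Lemma cons_rVK n : cancel (@cons_rV n) (@uncons_rV n).
Proof.
move=> [a v]; rewrite /uncons_rV /cons_rV mxE unlift_none /=; congr pair.
by apply/rowP => i; rewrite !mxE liftK.
Qed.

Lemma uncons_rVK n : cancel (@uncons_rV n) (@cons_rV n).
Proof.
move=> x; apply/rowP => i; rewrite mxE.
by case: unliftP => [j ->|->] /=; rewrite ?mxE.
Qed.

Lemma measurable_cons_rV n : measurable_fun setT (@cons_rV n).
Proof.
apply/measurable_fun_rVP => i; rewrite /cons_rV.
case: (unliftP ord0 i) => [j ->|->].
  rewrite (_ : (fun _ => _) = (fun x : 'rV[R]_n => x ord0 j) \o snd).
    by apply: measurableT_comp; [exact: measurable_rV_coord|].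
  by apply/funext => p; rewrite mxE liftK.
rewrite (_ : (fun _ => _) = fst); first exact: measurable_fst.
by apply/funext => p; rewrite mxE unlift_none.
Qed.

Lemma measurable_uncons_rV n : measurable_fun setT (@uncons_rV n).
Proof.
apply: measurable_fun_pair; first exact: measurable_rV_coord.
apply/measurable_fun_rVP => i.
rewrite (_ : (fun _ => _) = fun x : 'rV[R]_n.+1 => x ord0 (lift ord0 i)).
  exact: measurable_rV_coord.
by apply/funext => x; rewrite mxE.
Qed.

Section step.
Variables (n : nat) (mu : {sigma_finite_measure set 'rV[R]_n -> \bar R}).

Definition lebesgue_rV_step : set 'rV[R]_n.+1 -> \bar R :=
  pushforward (lebesgue_measure \x mu)%E (@cons_rV n).

Let step0 : lebesgue_rV_step set0 = 0%E.
Proof. by rewrite /lebesgue_rV_step /pushforward preimage_set0 measure0. Qed.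

Let step_ge0 A : (0 <= lebesgue_rV_step A)%E.
Proof. exact: (measure_ge0 (lebesgue_measure \x mu)%E). Qed.

Let step_sigma_additive : semi_sigma_additive lebesgue_rV_step.
Proof.
by apply: measure_semi_sigma_additive; exact: measurable_cons_rV.
Qed.

HB.instance Definition _ := isMeasure.Build _ _ _ lebesgue_rV_step
  step0 step_ge0 step_sigma_additive.

Let step_sigma_finite : sigma_finite setT lebesgue_rV_step.
Proof.
have /sigma_finiteP[F [TF ndF Foo]] := sigma_finiteT (@lebesgue_measure R).
have /sigma_finiteP[G [TG ndG Goo]] := sigma_finiteT mu.
have FGE k : @cons_rV n @^-1` (@uncons_rV n @^-1` (F k `*` G k)) = F k `*` G k.
  by rewrite -comp_preimage (_ : _ \o _ = id)//; exact/funext/cons_rVK.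
exists (fun k => @uncons_rV n @^-1` (F k `*` G k)).
  apply/seteqP; split=> // x _.
  have [/= i _ Fi] : (\bigcup_i F i) (uncons_rV x).1 by rewrite -TF.
  have [/= j _ Gj] : (\bigcup_i G i) (uncons_rV x).2 by rewrite -TG.
  exists (maxn i j) => //; split.
  - by move: Fi; exact/subsetPset/ndF/leq_maxl.
  - by move: Gj; exact/subsetPset/ndG/leq_maxr.
move=> k; have [mF Fk] := Foo k; have [mG Gk] := Goo k; split.
  rewrite -[X in measurable X]setTI; apply: measurable_uncons_rV => //.
  exact: measurableX.
by rewrite /lebesgue_rV_step /pushforward FGE product_measure1E//
  lte_mul_pinfty// ge0_fin_numE.
Qed.

HB.instance Definition _ := Measure_isSigmaFinite.Build _ _ _ lebesgue_rV_step
  step_sigma_finite.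

End step.

(* Lebesgue measure on R^n, as an iterated product; R^0 is a point of mass 1. *)
Fixpoint lebesgue_rV n : {sigma_finite_measure set 'rV[R]_n -> \bar R} :=
  match n with
  | 0 => \d_(0 : 'rV[R]_0)
  | n'.+1 => lebesgue_rV_step (lebesgue_rV n')
  end.

End lebesgue_rV.

Section sphere.
Context {R : realType}.

(* Euclidean norm; the library's `|x| on 'rV[R]_n is the sup norm. *)
Definition enorm n (x : 'rV[R]_n) : R := Num.sqrt (\sum_i x ord0 i ^+ 2).

Definition sphere n : set 'rV[R]_n := [set x | enorm x = 1].

Definition enormalize n (x : 'rV[R]_n) : 'rV[R]_n := (enorm x)^-1 *: x.

Definition punctured_ball n : set 'rV[R]_n := [set x | 0 < enorm x <= 1].

Lemma measurable_enorm n : measurable_fun setT (@enorm n).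
Proof.
apply: (measurableT_comp (continuous_measurable_fun (@sqrt_continuous R))).
apply: measurable_sum => i; apply: measurable_funX.
exact: measurable_rV_coord.
Qed.

Lemma measurable_enormalize n : measurable_fun setT (@enormalize n).
Proof.
apply/measurable_fun_rVP => i.
rewrite (_ : (fun _ => _) = fun x : 'rV[R]_n => enorm x `^ (-1) * x ord0 i).
  apply: measurable_funM; last exact: measurable_rV_coord.
  exact: (measurableT_comp (measurable_powR _) (@measurable_enorm n)).
by apply/funext => x; rewrite mxE powR_inv1// sqrtr_ge0.
Qed.

Lemma measurable_punctured_ball n : measurable (@punctured_ball n).
Proof.
rewrite (_ : @punctured_ball n = setT `&` (@enorm n @^-1` `]0, 1]%classic)).
  exact: measurable_enorm.
by apply/seteqP; split=> x; rewrite /punctured_ball /= in_itv /=; [|case].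
Qed.

(* Surface area of the unit sphere of R^n, as a measure on R^n carried by the
   sphere, in polar coordinates: the area of A is n times the volume of the cone
   {t y | y in A, |y| = 1, 0 < t <= 1}, n being 1 / \int_0^1 t^(n-1) dt. *)
Definition sphere_measure n (A : set 'rV[R]_n) : \bar R :=
  (n%:R%:E * lebesgue_rV n (@enormalize n @^-1` A `&` @punctured_ball n))%E.

Let sphere_measure0 n : sphere_measure (set0 : set 'rV[R]_n) = 0%E.
Proof. by rewrite /sphere_measure preimage_set0 set0I measure0 mule0. Qed.

Let sphere_measure_ge0 n (A : set 'rV[R]_n) : (0 <= sphere_measure A)%E.
Proof. by rewrite mule_ge0// lee_fin. Qed.

Let sphere_measure_sigma_additive n : semi_sigma_additive (@sphere_measure n).
Proof.
pose mu := mrestr (lebesgue_rV n : {measure set _ -> \bar R})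
  (@measurable_punctured_ball n).
have mu_sigma_additive : semi_sigma_additive (pushforward mu (@enormalize n)).
  by apply: measure_semi_sigma_additive; exact: measurable_enormalize.
move=> F mF tF mUF; rewrite [X in X @ \oo --> _](_ : _ =
    (fun k => n%:R%:E * \sum_(0 <= i < k) pushforward mu (@enormalize n) (F i))%E).
  by apply: cvgeZl => //; exact: mu_sigma_additive.
by apply/funext => k; rewrite ge0_sume_distrr// => i _; exact: (measure_ge0 mu).
Qed.

HB.instance Definition _ n := isMeasure.Build _ _ _ (@sphere_measure n)
  (@sphere_measure0 n) (@sphere_measure_ge0 n)
  (@sphere_measure_sigma_additive n).

End sphere.

Section distribution.
Context {R : realType}.

Definition Gamma (z : R) : R :=
  \int[lebesgue_measure]_(t in `]0, +oo[) (t `^ (z - 1) * expR (- t)).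

Definition cauchy_pdf d (phi y : 'rV[R]_d.+1) : R :=
  Gamma (d.+1%:R / 2) / (2 * pi `^ (d.+1%:R / 2)) *
  (`|1 - enorm phi ^+ 2| / enorm (y - phi) ^+ 2) ^+ d.

(* Y ~ C_d^*(phi).  As sphere_measure is carried by the sphere, Y is almost
   surely on it. *)
Definition spherical_cauchy d (dO : measure_display)
    (O : measurableType dO) (P : probability O R)
    (phi : 'rV[R]_d.+1) (Y : {RV P >-> 'rV[R]_d.+1}) : Prop :=
  forall A, measurable A ->
    distribution P Y A =
    (\int[@sphere_measure R d.+1]_(y in A) (cauchy_pdf phi y)%:E)%E.

Definition partial n (i : 'I_n) (g : 'rV[R]_n -> R) : 'rV[R]_n -> R :=
  fun x => 'D_(delta_mx ord0 i) g x.

Definition hessian n (g : 'rV[R]_n -> R) (x : 'rV[R]_n) : 'M[R]_n :=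
  \matrix_(i, j) partial i (partial j g) x.

(* 'D_v and fine are total; has_hessian and mx_integrable assert that the values
   above and below are genuine second partial derivatives and expectations. *)
Definition has_hessian n (g : 'rV[R]_n -> R) (x : 'rV[R]_n) : Prop :=
  forall i j : 'I_n,
    (\forall z \near x, derivable g z (delta_mx ord0 j)) /\
    derivable (partial j g) x (delta_mx ord0 i).

Definition mx_expectation (dO : measure_display)
    (O : measurableType dO) (P : probability O R) m n
    (X : O -> 'M[R]_(m, n)) : 'M[R]_(m, n) :=
  \matrix_(i, j) fine 'E_P[fun w => X w i j].

Definition mx_integrable (dO : measure_display)
    (O : measurableType dO) (P : probability O R) m n
    (X : O -> 'M[R]_(m, n)) : Prop :=
  forall i j, P.-integrable setT (fun w => (X w i j)%:E).

Definition log_likelihood_hessian d (phi y : 'rV[R]_d.+1) : 'M[R]_d.+1 :=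
  hessian (fun p => ln (cauchy_pdf p y)) phi.

Definition fisher_information d (dO : measure_display)
    (O : measurableType dO) (P : probability O R)
    (phi : 'rV[R]_d.+1) (Y : {RV P >-> 'rV[R]_d.+1}) : 'M[R]_d.+1 :=
  - mx_expectation P (fun w => log_likelihood_hessian phi (Y w)).

End distribution.

(* Main.v *)
(* Linear shears preserve Lebesgue measure, hence so do plane rotations, being
   products of three shears (the squares of such products for half turns), and
   therefore the surface measure of the sphere is rotation invariant.  Integrating
   d/dt u(R_t y) over a full turn shows that the derivative of u along a rotation
   field y_i d_j - y_j d_i has integral 0 over the sphere.  With
   l(y) = |y - phi|^2 = 1 + |phi|^2 - 2 phi.y, taking u = y_i w l^(-d-e) for w
   affine and e = 0, 1, and summing over i, gives linear relations between the
   expectations of 1/l, y_j/l, 1/l^2, y_j/l^2 and y_j y_m/l^2 under the density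
   proportional to l^(-d).  These relations determine all of them, and minus the
   Hessian of the log-likelihood is a combination of 1, 1/l and
   (y - phi)(y - phi)^T / l^2. *)

Require Import Defs.
From HB Require Import structures.
From mathcomp Require Import all_boot all_order all_algebra.
From mathcomp Require Import all_classical all_reals all_analysis.
From mathcomp Require Import measurable_realfun ring lra.

Import Order.TTheory GRing.Theory Num.Theory.
Import numFieldNormedType.Exports.

Local Open Scope classical_set_scope.
Local Open Scope ring_scope.

Set Implicit Arguments.
Unset Strict Implicit.
Unset Printing Implicit Defensive.

(** * Rotation invariance of the surface measure *)

Lemma lebesgue_measure_shift (R : realType) (c : R) (A : set R) :
  measurable A ->
  lebesgue_measure ((fun a => a + c) @^-1` A) = lebesgue_measure A.
Proof.
pose F (a : measurableTypeR R) : measurableTypeR R := a + c.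
have mF : measurable_fun setT F by exact: (@measurable_funD _ (measurableTypeR R)).
move=> mA; apply/esym; rewrite -[RHS]/(pushforward lebesgue_measure F A).
apply: (@lebesgue_measure_unique _ (pushforward _ F)) => //.
move=> _ [[a b] _ <-]/=.
rewrite /pushforward (_ : _ @^-1` _ = `]a - c, b - c]%classic).
  rewrite !lebesgue_measure_itv/= !lte_fin ltrD2r.
  by case: ifP => // _; rewrite -!EFinD; congr EFin; ring.
by apply/seteqP; split=> x /=; rewrite !in_itv/= ltrBlDr lerBrDr.
Qed.

Lemma cons_rV_shift_tail (R : realType) n (a : R) (v : 'rV[R]_n) j (t : R) :
  cons_rV (a, v) + t *: delta_mx ord0 (lift ord0 j) =
  cons_rV (a, v + t *: delta_mx ord0 j).
Proof.
apply/rowP => k; rewrite !mxE.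
case: (unliftP ord0 k) => [l ->|->] /=.
  by rewrite !mxE (inj_eq (@lift_inj _ ord0)).
by rewrite mulr0 addr0.
Qed.

Lemma cons_rV_shift_head (R : realType) n (a : R) (v : 'rV[R]_n) (t : R) :
  cons_rV (a, v) + t *: delta_mx ord0 ord0 = cons_rV (a + t, v).
Proof.
apply/rowP => k; rewrite !mxE.
case: (unliftP ord0 k) => [l ->|->] /=; last by rewrite mulr1.
by rewrite mulr0 addr0.
Qed.

Lemma measurable_preimage d1 d2 (T1 : measurableType d1) (T2 : measurableType d2)
    (f : T1 -> T2) (A : set T2) :
  measurable_fun setT f -> measurable A -> measurable (f @^-1` A).
Proof. by move=> mf mA; rewrite -[X in measurable X]setTI; exact: mf. Qed.

(** Induction on the dimension. If [i] is not the first coordinate, the slice at each fixed first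
    coordinate falls under the induction hypothesis. If [i] is the first one, Tonelli allows slicing
    at fixed remaining coordinates instead; [f] is constant on such a slice, so the map acts there
    as a translation of the line. *)
Lemma lebesgue_rV_shift (R : realType) n (i : 'I_n) (f : 'rV[R]_n -> R) :
  measurable_fun setT f -> (forall x t, f (x + t *: delta_mx ord0 i) = f x) ->
  forall A, measurable A ->
  lebesgue_rV n ((fun x => x + f x *: delta_mx ord0 i) @^-1` A) = lebesgue_rV n A.
Proof.
elim: n i f => [[]//|n IH] i f mf fi A mA.
have mcons := @measurable_cons_rV R n.
have mcA : measurable (@cons_rV R n @^-1` A) by exact: measurable_preimage.
have mtau : measurable_fun setT (fun x : 'rV[R]_n.+1 => x + f x *: delta_mx ord0 i).
  apply/measurable_fun_rVP => k.
  rewrite (_ : (fun _ => _) = fun x : 'rV[R]_n.+1 =>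
     x ord0 k + f x * (delta_mx ord0 i : 'rV[R]_n.+1) ord0 k); last first.
    by apply/funext => x; rewrite !mxE.
  apply: measurable_funD; first exact: measurable_rV_coord.
  by apply: measurable_funM.
have mctA : measurable
    (@cons_rV R n @^-1` ((fun x : 'rV[R]_n.+1 => x + f x *: delta_mx ord0 i) @^-1` A)).
  by do 2 apply: measurable_preimage => //.
have mca (a : R) : measurable_fun setT (fun v => f (cons_rV (a, v))).
  apply: (measurableT_comp mf); apply: (measurableT_comp mcons).
  exact: measurable_pair1.
rewrite /= /lebesgue_rV_step /pushforward.
case: (unliftP ord0 i) => [j|] iE; subst i.
  rewrite /product_measure1; apply: eq_integral => a _ /=.
  rewrite -[RHS](IH j (fun v => f (cons_rV (a, v)))) //; last exact: measurable_xsection.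
    congr (lebesgue_rV n _).
    by rewrite !xsectionE; apply/seteqP; split => v /=; rewrite cons_rV_shift_tail.
  by move=> v t; rewrite -cons_rV_shift_tail fi.
have tonelli B : measurable B -> (lebesgue_measure \x lebesgue_rV n)%E B =
    (@lebesgue_measure R \x^ lebesgue_rV n)%E B.
  apply: product_measure_unique => ? ? ? ?; exact: product_measure2E.
rewrite !tonelli// /product_measure2; apply: eq_integral => v _ /=.
pose c := f (cons_rV (0, v)).
rewrite -[RHS](@lebesgue_measure_shift _ c); last exact: measurable_ysection.
congr (lebesgue_measure _); rewrite !ysectionE.
have fE a : f (cons_rV (a, v)) = c.
  by rewrite -[a]add0r -cons_rV_shift_head fi.
by apply/seteqP; split => a /=; rewrite cons_rV_shift_head fE.
Qed.

(** The Givens rotation of angle a in the plane of coordinates [i] and [j], when c = cos a and s =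
    sin a. Writing it as the identity plus two corrections gives all coordinates by the single
    formula [givensE]. *)
Definition givens (R : realType) n (i j : 'I_n) (c s : R) (x : 'rV[R]_n) : 'rV[R]_n :=
  x + ((c - 1) * x ord0 i - s * x ord0 j) *: delta_mx ord0 i
    + (s * x ord0 i + (c - 1) * x ord0 j) *: delta_mx ord0 j.

Lemma givensE (R : realType) n (i j : 'I_n) (c s : R) (x : 'rV[R]_n) k :
  givens i j c s x ord0 k = x ord0 k
    + ((c - 1) * x ord0 i - s * x ord0 j) * (k == i)%:R
    + (s * x ord0 i + (c - 1) * x ord0 j) * (k == j)%:R.
Proof. by rewrite !mxE !eqxx. Qed.

Lemma givens_i (R : realType) n (i j : 'I_n) (c s : R) (x : 'rV[R]_n) : i != j ->
  givens i j c s x ord0 i = c * x ord0 i - s * x ord0 j.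
Proof. by move=> /negbTE ij; rewrite givensE eqxx ij /=; ring. Qed.

Lemma givens_j (R : realType) n (i j : 'I_n) (c s : R) (x : 'rV[R]_n) : i != j ->
  givens i j c s x ord0 j = s * x ord0 i + c * x ord0 j.
Proof. by move=> /negbTE ij; rewrite givensE eqxx eq_sym ij /=; ring. Qed.

Lemma givens_other (R : realType) n (i j k : 'I_n) (c s : R) (x : 'rV[R]_n) :
  k != i -> k != j -> givens i j c s x ord0 k = x ord0 k.
Proof. by move=> /negbTE ki /negbTE kj; rewrite givensE ki kj /=; ring. Qed.

Lemma measurable_givens (R : realType) n (i j : 'I_n) (c s : R) :
  measurable_fun setT (@givens R n i j c s).
Proof.
apply/measurable_fun_rVP => k; under eq_fun do rewrite givensE.
have mk := @measurable_rV_coord _ R n.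
by repeat first [exact: mk | apply: measurable_funB | apply: measurable_funD |
  apply: measurable_funM | exact: measurable_cst].
Qed.

Lemma givensZ (R : realType) n (i j : 'I_n) (c s a : R) (x : 'rV[R]_n) :
  givens i j c s (a *: x) = a *: givens i j c s x.
Proof. by apply/rowP => k; rewrite !mxE; ring. Qed.

Lemma enorm_givens (R : realType) n (i j : 'I_n) (c s : R) (x : 'rV[R]_n) :
  i != j -> c ^+ 2 + s ^+ 2 = 1 -> enorm (givens i j c s x) = enorm x.
Proof.
move=> ij cs; congr Num.sqrt; have ji : j != i by rewrite eq_sym.
rewrite [LHS](bigD1 i)//= [RHS](bigD1 i)//=.
rewrite [X in _ + X = _](bigD1 j)//= [X in _ = _ + X](bigD1 j)//=.
rewrite !addrA; congr +%R; last first.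
  by apply: eq_bigr => k /andP[ki kj]; rewrite givens_other.
rewrite givens_i// givens_j//.
rewrite -[RHS]mul1r -cs; ring.
Qed.

Lemma enormalize_givens (R : realType) n (i j : 'I_n) (c s : R) (x : 'rV[R]_n) :
  i != j -> c ^+ 2 + s ^+ 2 = 1 ->
  enormalize (givens i j c s x) = givens i j c s (enormalize x).
Proof. by move=> ij cs; rewrite /enormalize enorm_givens// givensZ. Qed.

(* If c = cos a and s = sin a, then t = - tan (a / 2). *)
Lemma givens_shears (R : realType) n (i j : 'I_n) (c s : R) : i != j ->
  c != -1 -> c ^+ 2 + s ^+ 2 = 1 ->
  let shear i j t := fun x : 'rV[R]_n => x + (t * x ord0 j) *: delta_mx ord0 i in
  let t := - (s / (1 + c)) in
  givens i j c s = shear i j t \o shear j i s \o shear i j t.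
Proof.
move=> ij c1 cs shear t; have ji : j != i by rewrite eq_sym.
have c0 : 1 + c != 0 by rewrite addrC addr_eq0.
have s2 : s * t = c - 1.
  rewrite /t; apply: (mulIf c0); rewrite mulrN mulrA mulNr divfK//.
  by rewrite -expr2 -[s ^+ 2](addKr (c ^+ 2)) cs; ring.
have ts : t * (1 + c) = - s by rewrite /t mulNr divfK.
apply/funext => x; apply/rowP => k; rewrite givensE /shear /= !mxE !eqxx /=.
rewrite (negbTE ji) /= !(mulr0, mulr1, addr0).
have [->|ki] := eqVneq k i.
  rewrite (negbTE ij) /= !(mulr0, mulr1, addr0) mulrDr.
  have -> : t * (s * (x ord0 i + t * x ord0 j)) = s * t * (x ord0 i + t * x ord0 j) by ring.
  rewrite s2 -[in LHS](opprK s) -ts; ring.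
rewrite /= !(mulr0, mulr1, addr0).
have [->|kj] := eqVneq k j; last by rewrite /= !(mulr0, addr0).
by rewrite /= !mulr1 mulrDr mulrA s2; ring.
Qed.

Lemma lebesgue_rV_givens (R : realType) n (i j : 'I_n) (c s : R) A :
  i != j -> c ^+ 2 + s ^+ 2 = 1 -> measurable A ->
  lebesgue_rV n (givens i j c s @^-1` A) = lebesgue_rV n A.
Proof.
move=> ij; move: c s A.
have gen (c s : R) (A : set 'rV[R]_n) : c != -1 -> c ^+ 2 + s ^+ 2 = 1 -> measurable A ->
    lebesgue_rV n (givens i j c s @^-1` A) = lebesgue_rV n A.
  move=> c1 cs mA; rewrite givens_shears//.
  pose shear (i j : 'I_n) t (x : 'rV[R]_n) : 'rV[R]_n := x + (t * x ord0 j) *: delta_mx ord0 i.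
  have sh k l t B : k != l -> measurable B ->
     measurable (shear k l t @^-1` B) /\ lebesgue_rV n (shear k l t @^-1` B) = lebesgue_rV n B.
    move=> /negbTE kl mB; have mf : measurable_fun setT (fun x : 'rV[R]_n => t * x ord0 l).
      by apply: measurable_funM => //; exact: measurable_rV_coord.
    split.
      apply: measurable_preimage => //; apply/measurable_fun_rVP => m.
      under eq_fun do rewrite !mxE.
      apply: measurable_funD; first exact: measurable_rV_coord.
      by apply: measurable_funM.
    apply: (@lebesgue_rV_shift R n k (fun x => t * x ord0 l)) => // x u.
    by rewrite !mxE eqxx eq_sym kl mulr0 addr0.
  have ji : j != i by rewrite eq_sym.
  set t := - _.
  rewrite -[LHS]/(lebesgue_rV n (shear i j t @^-1`
    (shear j i s @^-1` (shear i j t @^-1` A)))).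
  have [m1 e1] := sh i j t A ij mA.
  have [m2 e2] := sh j i s _ ji m1.
  have [m3 e3] := sh i j t _ ij m2.
  by rewrite e3 e2 e1.
move=> c s A cs mA; have [c1|] := eqVneq c (-1); last by move=> ?; exact: gen.
have s0 : s = 0 by apply/eqP; rewrite -sqrf_eq0 -(addKr (c ^+ 2) (s ^+ 2)) cs c1 sqrrN expr1n addNr.
(* The shear decomposition divides by 1 + c, so the half turn is obtained as the square of the
   quarter turn. *)
have -> : givens i j c s = givens i j 0 1 \o givens i j 0 1.
  apply/funext => x; apply/rowP => k; rewrite /= c1 s0.
  have [->|ki] := eqVneq k i; first by rewrite !givens_i// givens_j//; ring.
  have [->|kj] := eqVneq k j; first by rewrite !givens_j// givens_i//; ring.
  by rewrite !givens_other.
have N1 : (0 : R) != -1 by rewrite eq_sym oppr_eq0 oner_eq0.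
have cs1 : 0 ^+ 2 + 1 ^+ 2 = 1 :> R by rewrite expr0n expr1n add0r.
rewrite -[LHS]/(lebesgue_rV n (givens i j 0 1 @^-1` (givens i j 0 1 @^-1` A))) !gen//.
by apply: measurable_preimage => //; exact: measurable_givens.
Qed.

(** Rotations preserve the norm and commute with [enormalize], so the cone over the preimage of [A]
    is the preimage of the cone over [A]. *)
Lemma sphere_measure_givens (R : realType) n (i j : 'I_n) (c s : R) A :
  i != j -> c ^+ 2 + s ^+ 2 = 1 -> measurable A ->
  sphere_measure (givens i j c s @^-1` A) = sphere_measure A.
Proof.
move=> ij cs mA; rewrite /sphere_measure; congr (_ * _)%E.
rewrite -[RHS](@lebesgue_rV_givens _ _ i j c s)//.
  congr (lebesgue_rV n _); apply/seteqP; split => x /=;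
    by rewrite /punctured_ball /= enorm_givens// enormalize_givens.
apply: measurableI; last exact: measurable_punctured_ball.
by apply: measurable_preimage => //; exact: measurable_enormalize.
Qed.

(** * Support and finiteness of the surface measure *)

Lemma enorm_sqr (R : realType) n (x : 'rV[R]_n) :
  enorm x ^+ 2 = \sum_i x ord0 i ^+ 2.
Proof. by rewrite sqr_sqrtr// sumr_ge0// => i _; exact: sqr_ge0. Qed.

Lemma sphere_sum (R : realType) n (x : 'rV[R]_n) :
  sphere x -> \sum_i x ord0 i ^+ 2 = 1.
Proof. by rewrite /sphere /= -enorm_sqr => ->; rewrite expr1n. Qed.

Lemma coord_le_enorm (R : realType) n (x : 'rV[R]_n) i :
  `|x ord0 i| <= enorm x.
Proof.
rewrite -sqrtr_sqr ler_wsqrtr// (bigD1 i)//= lerDl sumr_ge0// => j _.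
exact: sqr_ge0.
Qed.

Lemma measurable_sphere (R : realType) n : measurable (@sphere R n).
Proof.
rewrite (_ : @sphere R n = @enorm R n @^-1` [set 1])//.
by apply: measurable_preimage => //; exact: measurable_enorm.
Qed.

(** A nonzero vector is normalised onto the sphere, so the cone over the complement is empty. *)
Lemma sphere_measureC (R : realType) n :
  sphere_measure (~` @sphere R n) = 0%E.
Proof.
rewrite /sphere_measure (_ : _ `&` _ = set0) ?measure0 ?mule0//.
apply/seteqP; split => // x; rewrite /punctured_ball /= => -[nx /andP[x0 _]].
apply: nx.
rewrite /sphere /= /enorm /enormalize.
under eq_bigr do rewrite mxE exprMn.
rewrite -mulr_sumr -enorm_sqr -exprMn mulVf ?gt_eqF//.
by rewrite expr1n sqrtr1.
Qed.

Lemma measurable_cube (R : realType) n :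
  measurable [set x : 'rV[R]_n | forall i, `|x ord0 i| <= 1].
Proof.
rewrite (_ : mkset _ = \bigcap_(i in [set: 'I_n])
      ((fun x : 'rV[R]_n => x ord0 i) @^-1` `[-1, 1]%classic)); last first.
    apply/seteqP; split=> x /= H i; have := H i; rewrite /= in_itv/= -ler_norml//.
    exact.
  apply: fin_bigcap_measurable => // i _; apply: measurable_preimage => //.
  exact: measurable_rV_coord.
Qed.

(** The cube contains the punctured ball, whence the finiteness of the surface measure. *)
Lemma lebesgue_rV_cube (R : realType) n :
  (lebesgue_rV n [set x : 'rV[R]_n | forall i, (`|x ord0 i| <= 1)%R] < +oo)%E.
Proof.
elim: n => [|n IH].
  by rewrite /= diracE; case: (_ \in _); rewrite ltry.
rewrite /= /lebesgue_rV_step /pushforward.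
rewrite (_ : _ @^-1` _ = `[-1, 1]%classic `*`
    [set x : 'rV[R]_n | forall i, `|x ord0 i| <= 1]); last first.
  apply/seteqP; split => -[a v] /=; rewrite in_itv/= -ler_norml.
    move=> H; split=> [|i].
      by have := H ord0; rewrite mxE unlift_none.
    by have := H (lift ord0 i); rewrite mxE liftK.
  move=> [a1 v1] i; rewrite mxE; case: (unliftP ord0 i) => [j _|_] //=.
rewrite product_measure1E//; last exact: measurable_cube.
rewrite [X in (X * _)%E]lebesgue_measure_itv/= lte_fin.
rewrite ifT; last by rewrite -subr_gt0 opprK addr_gt0.
by rewrite -EFinB lte_mul_pinfty.
Qed.

Lemma sphere_measure_fin (R : realType) n :
  (sphere_measure [set: 'rV[R]_n] < +oo)%E.
Proof.
rewrite /sphere_measure; apply: lte_mul_pinfty => //.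
apply: le_lt_trans (lebesgue_rV_cube R n); apply: le_measure.
- by rewrite inE preimage_setT setTI; exact: measurable_punctured_ball.
- by rewrite inE; exact: measurable_cube.
- move=> x; rewrite /punctured_ball /= => -[_ /andP[_ x1]] i.
  exact: le_trans (coord_le_enorm _ _) x1.
Qed.

(** * Derivatives along rotations integrate to zero *)

HB.instance Definition _ (R : realType) n := Measure_isFinite.Build _ _ _
  (@sphere_measure R n) (lty_fin_num_fun (sphere_measure_fin R n)).

Lemma sphere_integral_givens (R : realType) n (i j : 'I_n) (c s : R) (f : 'rV[R]_n -> R) :
  i != j -> c ^+ 2 + s ^+ 2 = 1 -> measurable_fun setT f ->
  (@sphere_measure R n).-integrable setT (EFin \o (f \o givens i j c s)) ->
  (\int[@sphere_measure R n]_y (f (givens i j c s y))%:E =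
   \int[@sphere_measure R n]_y (f y)%:E)%E.
Proof.
move=> ij cs mf fi; have mgivens := measurable_givens i j c s.
rewrite [RHS](eq_measure_integral (pushforward (@sphere_measure R n) (givens i j c s))).
  rewrite (integral_pushforward mgivens)//; exact/measurable_EFinP.
by move=> A mA _; rewrite /= /pushforward sphere_measure_givens.
Qed.

(** Joint measurability in the angle and the point, as Fubini requires below. *)
Lemma measurable_givens_param (R : realType) n (i j : 'I_n) :
  measurable_fun setT (fun p : measurableTypeR R * 'rV[R]_n =>
    givens i j (cos p.1) (sin p.1) p.2).
Proof.
apply/measurable_fun_rVP => k; under eq_fun do rewrite givensE.
have mk l : measurable_fun setT (fun p : measurableTypeR R * 'rV[R]_n => p.2 ord0 l).
  exact: (measurableT_comp (measurable_rV_coord l)).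
have mcos : measurable_fun setT (fun p : measurableTypeR R * 'rV[R]_n => cos p.1).
  apply: (measurableT_comp (continuous_measurable_fun (@continuous_cos R))).
  exact: measurable_fst.
have msin : measurable_fun setT (fun p : measurableTypeR R * 'rV[R]_n => sin p.1).
  apply: (measurableT_comp (continuous_measurable_fun (@continuous_sin R))).
  exact: measurable_fst.
by repeat first [exact: mk | exact: mcos | exact: msin | apply: measurable_funB |
  apply: measurable_funD | apply: measurable_funM | exact: measurable_cst].
Qed.

Lemma sphere_integral_givens_derive (R : realType) n (i j : 'I_n)
    (u Du : 'rV[R]_n -> R) (M : R) : i != j -> measurable_fun setT Du ->
  (forall y, sphere y -> `|Du y| <= M) ->
  (forall y (t : R), sphere y -> is_derive t 1
     (fun t => u (givens i j (cos t) (sin t) y)) (Du (givens i j (cos t) (sin t) y))) ->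
  (forall y, sphere y -> continuous (fun t : R => Du (givens i j (cos t) (sin t) y))) ->
  (\int[@sphere_measure R n]_(y in sphere (n := n)) (Du y)%:E = 0)%E.
Proof.
move=> ij mDu DuM uDu cDu.
have cs t : cos t ^+ 2 + sin t ^+ 2 = 1 :> R by exact: cos2Dsin2.
pose f := Du \_ (@sphere R n).
have mf : measurable_fun setT f.
  apply: (iffLR (measurable_restrictT _ (@measurable_sphere R n))).
  exact: measurable_funTS.
(* The absolute value keeps the bound valid off the sphere, where [f] is 0. *)
pose M' := `|M|.
have fM y : `|f y| <= M'.
  rewrite /f patchE; case: ifPn => [|_]; last by rewrite normr0 /M' normr_ge0.
  by rewrite inE => /DuM /le_trans; apply; exact: ler_norm.
pose r (p : measurableTypeR R * 'rV[R]_n) := givens i j (cos p.1) (sin p.1) p.2.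
pose I : set (measurableTypeR R) := `[0, pi *+ 2]%classic.
have mI : measurable I by exact: measurable_itv.
pose k p := f (r p).
have mk : measurable_fun setT k.
  by apply: (measurableT_comp mf); exact: measurable_givens_param.
have bdk (T : Type) (A : set T) (g : T -> 'rV[R]_n) : [bounded f (g x) | x in A].
  by exists M'; split; [exact: num_real|move=> N MN x _; exact: le_trans (fM _) (ltW MN)].
have pi2 : (0 : R) < pi *+ 2 by rewrite mulrn_wgt0// pi_gt0.
have lI : @lebesgue_measure R I = (pi *+ 2)%:E.
  by rewrite /I lebesgue_measure_itv/= lte_fin pi2 oppr0 adde0.
have leI : (@lebesgue_measure R I < +oo)%E by rewrite lI ltry.
have intS (c s : R) : (@sphere_measure R n).-integrable setT (EFin \o (f \o givens i j c s)).
  apply: measurable_bounded_integrable => //; first exact: sphere_measure_fin.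
    by apply: (measurableT_comp mf); exact: measurable_givens.
  exact: bdk.
have leIS : ((@lebesgue_measure R \x @sphere_measure R n) (I `*` setT) < +oo)%E.
  rewrite product_measure1E//; apply: lte_mul_pinfty; first exact: measure_ge0.
    by rewrite ge0_fin_numE// measure_ge0.
  exact: sphere_measure_fin.
have intk : (@lebesgue_measure R \x @sphere_measure R n)%E.-integrable setT
    ((EFin \o k) \_ (I `*` setT)).
  apply: (iffLR (integrable_mkcond _ _)); first exact: measurableX.
  apply: measurable_bounded_integrable.
  - exact: measurableX.
  - exact: leIS.
  - exact: measurable_funTS.
  - exact: bdk.
have kE t y : ((EFin \o k) \_ (I `*` setT)) (t, y) =
    ((fun t => (k (t, y))%:E) \_ I) t.
  rewrite !patchE; congr (if _ then _ else _).
  by apply/idP/idP; rewrite !inE /= => -[].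
(* Integrating over [y] first, rotation invariance makes the inner integral independent of [t], so
   the left side is 2 pi times the integral sought. *)
have := Fubini intk.
under eq_integral => t _.
  under eq_integral do rewrite kE patchE.
  rewrite (_ : integral _ _ _ =
    ((fun _ => \int[@sphere_measure R n]_y (f y)%:E) \_ I) t)%E; last first.
    rewrite patchE; case: ifPn => tI; last by rewrite integral0.
    exact: (sphere_integral_givens ij (cs t) mf (intS _ _)).
  over.
rewrite -integral_mkcond.
(* Integrating over [t] first, the fundamental theorem of calculus gives the values of [u] at angles
   2 pi and 0, which cancel; off the sphere [f] vanishes along the whole orbit. *)
rewrite [RHS]integral0_eq; last first.
  move=> y _; under eq_integral do rewrite kE.
  rewrite -integral_mkcond.
  have [Sy|nSy] := pselect (sphere y); last first.
    rewrite integral0_eq// => t _; rewrite /k /f patchE ifF//.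
    apply/negbTE; rewrite notin_setE /r /= /sphere /=.
    by rewrite enorm_givens.
  have kD t : k (t, y) = Du (r (t, y)).
    by rewrite /k /f patchE ifT// inE /sphere /= enorm_givens.
  under eq_integral do rewrite kD.
  rewrite (@continuous_FTC2 _ _ (fun t => u (r (t, y))))//.
  - by rewrite /r /= cos2pi sin2pi cos0 sin0 subee.
  - exact/continuous_subspaceT/cDu.
  - have cu : continuous (fun t => u (r (t, y))).
      by move=> t; apply/differentiable_continuous/derivable1_diffP; have [] := uDu y t Sy.
    split.
    + by move=> t _; have [] := uDu y t Sy.
    + by apply: cvg_at_right_filter; exact: cu.
    + by apply: cvg_at_left_filter; exact: cu.
  - by move=> t _; rewrite derive1E; have [_] := uDu y t Sy.
have If : (\int[@sphere_measure R n]_y (f y)%:E)%E \is a fin_num.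
  apply: integrable_fin_num => //.
  apply: measurable_bounded_integrable => //; first exact: sphere_measure_fin.
rewrite -(fineK If) integral_cst// [X in (_ * X)%E]lI -EFinM => -[] /eqP.
rewrite mulf_eq0 (gt_eqF pi2) orbF => /eqP If0.
rewrite integral_mkcond; transitivity (\int[@sphere_measure R n]_y (f y)%:E)%E.
  by apply: eq_integral => y _; rewrite restrict_EFin.
by rewrite -(fineK If) If0.
Qed.

(** * Calculus of derivatives along plane rotations *)

Definition dot (R : realType) n (b x : 'rV[R]_n) : R := \sum_k b ord0 k * x ord0 k.

(** The real power with exponent -1 is the inverse on nonnegative arguments, hence the detour
    through the square of [f]. Where [f] vanishes both sides are 0, as 0 has inverse 0. *)
Lemma measurable_invr (R : realType) d (T : measurableType d) (f : T -> R) :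
  measurable_fun setT f -> measurable_fun setT (fun y => (f y)^-1).
Proof.
move=> mf; rewrite (_ : (fun _ => _) = fun y => f y * (f y ^+ 2) `^ (-1)).
  apply: measurable_funM => //.
  by apply: (measurableT_comp (measurable_powR _)); exact: measurable_funX.
apply/funext => y; rewrite powR_inv1 ?sqr_ge0// expr2 invfM mulrA.
have [->|f0] := eqVneq (f y) 0; first by rewrite invr0 mulr0.
by rewrite mulfV// mul1r.
Qed.

Section tame.
Variables (R : realType) (n : nat) (i j : 'I_n).
Hypothesis ij : i != j.

Let orbit (y : 'rV[R]_n) (t : R) := givens i j (cos t) (sin t) y.

Let sphere_orbit y t : sphere y -> sphere (orbit y t).
Proof. by rewrite /sphere /= enorm_givens// cos2Dsin2. Qed.

(** Gathers what [sphere_integral_givens_derive] asks of a derivative, in a form stable under sums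
    and products, so that it can be checked term by term. *)
Definition tame (f : 'rV[R]_n -> R) :=
  [/\ measurable_fun setT f,
      exists M, forall y, sphere y -> `|f y| <= M
    & forall y, sphere y -> continuous (fun t => f (orbit y t))].

(* Df is the derivative of f along the rotation field y_i d_j - y_j d_i. *)
Definition givens_derive (f Df : 'rV[R]_n -> R) :=
  forall y (t : R), sphere y ->
    is_derive t 1 (fun t => f (orbit y t)) (Df (orbit y t)).

Lemma tameD f g : tame f -> tame g -> tame (fun y => f y + g y).
Proof.
move=> [mf [M fM] cf] [mg [N gN] cg]; split.
- exact: measurable_funD.
- exists (M + N) => y Sy; rewrite (le_trans (ler_normD _ _))// lerD//;
    [exact: fM|exact: gN].
- by move=> y Sy t; apply: continuousD; [exact: cf|exact: cg].
Qed.

Lemma tameM f g : tame f -> tame g -> tame (fun y => f y * g y).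
Proof.
move=> [mf [M fM] cf] [mg [N gN] cg]; split.
- exact: measurable_funM.
- exists (M * N) => y Sy; rewrite normrM ler_pM//; [exact: fM|exact: gN].
- by move=> y Sy t; apply: continuousM; [exact: cf|exact: cg].
Qed.

Lemma tame_cst c : tame (fun=> c).
Proof.
by split => //; [exists (`|c|) | move=> y _ t; exact: cvg_cst].
Qed.

Lemma tameX f k : tame f -> tame (fun y => f y ^+ k).
Proof.
move=> tf; elim: k => [|k IH]; first exact: tame_cst.
by under eq_fun do rewrite exprS; exact: tameM.
Qed.

Lemma tame_sum (I : Type) (s : seq I) (F : I -> 'rV[R]_n -> R) :
  (forall i, tame (F i)) -> tame (fun y => \sum_(i <- s) F i y).
Proof.
move=> tF; elim: s => [|a s IH].
  by under eq_fun do rewrite big_nil; exact: tame_cst.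
by under eq_fun do rewrite big_cons; exact: tameD.
Qed.

Lemma givens_deriveD f g Df Dg : givens_derive f Df -> givens_derive g Dg ->
  givens_derive (fun y => f y + g y) (fun y => Df y + Dg y).
Proof. by move=> df dg y t Sy; apply: is_deriveD; [exact: df|exact: dg]. Qed.

Lemma givens_deriveM f g Df Dg : givens_derive f Df -> givens_derive g Dg ->
  givens_derive (fun y => f y * g y) (fun y => f y * Dg y + g y * Df y).
Proof. by move=> df dg y t Sy; apply: is_deriveM; [exact: df|exact: dg]. Qed.

Lemma givens_derive_eq f f' Df Df' : givens_derive f Df -> f =1 f' ->
  Df =1 Df' -> givens_derive f' Df'.
Proof. by move=> df /funext <- /funext <-. Qed.

Lemma givens_derive_cst c : givens_derive (fun=> c) (fun=> 0).
Proof. by move=> y t Sy; apply: is_derive_cst. Qed.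

Lemma givens_deriveX f k Df : givens_derive f Df ->
  givens_derive (fun y => f y ^+ k) (fun y => k%:R * f y ^+ k.-1 * Df y).
Proof.
move=> df; elim: k => [|k IH].
  by apply: (givens_derive_eq (givens_derive_cst 1)) => y; rewrite ?expr0 ?mul0r.
apply: (givens_derive_eq (givens_deriveM df IH)) => y; first by rewrite exprS.
case: k {IH} => [|k] /=; first by rewrite expr0 !mul0r; ring.
by rewrite [f y ^+ k.+1]exprS -[k.+2%:R]natr1 mulrDl mulrDl; ring.
Qed.

Lemma givens_deriveV f Df : givens_derive f Df -> (forall y, sphere y -> f y != 0) ->
  givens_derive (fun y => (f y)^-1) (fun y => - (f y)^-1 ^+ 2 * Df y).
Proof.
move=> df f0 y t Sy; rewrite exprVn; apply: is_deriveV.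
- exact/f0/sphere_orbit.
- exact: df.
Qed.

Lemma givens_derive_coord k :
  givens_derive (fun y => y ord0 k)
    (fun y => y ord0 i * (k == j)%:R - y ord0 j * (k == i)%:R).
Proof.
move=> y t Sy; rewrite /orbit givens_i// givens_j//.
under eq_fun do rewrite givensE.
set A := y ord0 i; set B := y ord0 j; set C := y ord0 k.
(* Along an orbit each coordinate is a constant plus a linear combination of cos and sin; one
   expression serves [k = i], [k = j] and the other [k]. *)
rewrite (_ : (fun _ => _) =
    ((cst (C - A * (k == i)%:R - B * (k == j)%:R)
      + (A * (k == i)%:R + B * (k == j)%:R) \*: @cos R)
      + (A * (k == j)%:R - B * (k == i)%:R) \*: @sin R)); last first.
  apply/funext => u; rewrite /cst /=.
  rewrite -[RHS]/(C - A * (k == i)%:R - B * (k == j)%:R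
    + (A * (k == i)%:R + B * (k == j)%:R) * cos u
    + (A * (k == j)%:R - B * (k == i)%:R) * sin u).
  ring.
apply: is_derive_eq.
rewrite -[LHS]/(0 + (A * (k == i)%:R + B * (k == j)%:R) * (- sin t)
    + (A * (k == j)%:R - B * (k == i)%:R) * cos t).
ring.
Qed.

Lemma givens_derive_sum (I : Type) (s : seq I) (F DF : I -> 'rV[R]_n -> R) :
  (forall i, givens_derive (F i) (DF i)) ->
  givens_derive (fun y => \sum_(i <- s) F i y) (fun y => \sum_(i <- s) DF i y).
Proof.
move=> dF; elim: s => [|a s IH].
  by apply: (givens_derive_eq (givens_derive_cst 0)) => y; rewrite big_nil.
by apply: (givens_derive_eq (givens_deriveD (dF a) IH)) => y; rewrite big_cons.
Qed.

Lemma givens_derive_dot b : givens_derive (dot b)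
  (fun y => b ord0 j * y ord0 i - b ord0 i * y ord0 j).
Proof.
have H := givens_derive_sum (index_enum 'I_n) (fun k =>
  givens_deriveM (givens_derive_cst (b ord0 k)) (givens_derive_coord k)).
apply: (givens_derive_eq H) => // y {H} /=; under eq_bigr do rewrite mulr0 addr0 mulrBr.
rewrite big_split sumrN /=; congr (_ - _).
  rewrite (bigD1 j)//= eqxx mulr1 big1 ?addr0// => k /negbTE ->.
  by rewrite !mulr0.
rewrite (bigD1 i)//= eqxx mulr1 big1 ?addr0// => k /negbTE ->.
by rewrite !mulr0.
Qed.

Lemma givens_derive_continuous f Df : givens_derive f Df ->
  forall y, sphere y -> continuous (fun t => f (orbit y t)).
Proof.
move=> df y Sy t; apply/differentiable_continuous/derivable1_diffP.
by have [] := df y t Sy.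
Qed.

Lemma tame_coord k : tame (fun y => y ord0 k).
Proof.
split; first exact: measurable_rV_coord.
- by exists 1 => y; rewrite /sphere /= => <-; exact: coord_le_enorm.
- exact: givens_derive_continuous (givens_derive_coord k).
Qed.

Lemma tame_dot b : tame (dot b).
Proof.
apply: tame_sum => k; apply: tameM; [exact: tame_cst|exact: tame_coord].
Qed.

Lemma tameV (f Df : 'rV[R]_n -> R) m : 0 < m -> (forall y, sphere y -> m <= f y) ->
  measurable_fun setT f -> givens_derive f Df -> tame (fun y => (f y)^-1).
Proof.
move=> m0 mf mef df.
have f0 y : sphere y -> f y != 0.
  by move=> Sy; rewrite gt_eqF// (lt_le_trans m0)// mf.
split.
- exact: measurable_invr.
- exists m^-1 => y Sy; have mfy := mf y Sy.
  rewrite ger0_norm ?invr_ge0 ?(le_trans (ltW m0))// lef_pV2 ?posrE//.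
  exact: lt_le_trans m0 mfy.
- exact: givens_derive_continuous (givens_deriveV df f0).
Qed.

Lemma sphere_integral_givens_derive0 f Df : givens_derive f Df -> tame Df ->
  (\int[@sphere_measure R n]_(y in sphere (n := n)) (Df y)%:E = 0)%E.
Proof.
move=> df [mD [M DM] cD].
exact: (sphere_integral_givens_derive ij mD DM df cD).
Qed.

End tame.

(** * Linear relations between the moments *)

Section centered.
Variables (R : realType) (d : nat) (phi : 'rV[R]_d.+1).
Hypothesis hphi : enorm phi < 1.

(** The affine function that agrees with the squared distance to [phi] on the sphere; being affine,
    it has a derivative along rotations that is linear in [y]. *)
Definition ell (y : 'rV[R]_d.+1) : R := 1 + enorm phi ^+ 2 - 2 * dot phi y.

Lemma ellE y : sphere y -> ell y = enorm (y - phi) ^+ 2.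
Proof.
move=> Sy; rewrite /ell /dot !enorm_sqr.
rewrite -[X in X + _ - _](sphere_sum Sy) mulr_sumr -big_split -sumrB.
by apply: eq_bigr => k _; rewrite !mxE /=; ring.
Qed.

Lemma enorm_sqr_lt1 : enorm phi ^+ 2 < 1.
Proof. by rewrite expr_lt1// sqrtr_ge0. Qed.

Let a : R := (1 + enorm phi ^+ 2) / 2.

(* From 2 phi_k y_k <= phi_k^2 / a + a y_k^2 and |phi|^2 < a < 1. *)
Lemma ell_lower : exists2 m : R, 0 < m & forall y, sphere y -> m <= ell y.
Proof.
have s1 := enorm_sqr_lt1; have s0 : 0 <= enorm phi ^+ 2 by exact: sqr_ge0.
have a0 : 0 < a by rewrite /a; lra.
have a1 : a < 1 by rewrite /a; lra.
have sa : enorm phi ^+ 2 < a by rewrite /a; lra.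
(* Summing the inequality over k gives 2 phi.y <= |phi|^2 / a + a, and 1 + |phi|^2 - |phi|^2 / a - a
   factors as this product, positive because |phi|^2 < a < 1. *)
exists ((1 - a) * (1 - enorm phi ^+ 2 / a)).
  by rewrite mulr_gt0 ?subr_gt0// ltr_pdivrMr// mul1r.
move=> y Sy; rewrite -subr_ge0.
have -> : ell y - (1 - a) * (1 - enorm phi ^+ 2 / a)
    = enorm phi ^+ 2 / a + a * 1 - 2 * dot phi y.
  by rewrite /ell; field; rewrite gt_eqF.
rewrite -[X in a * X](sphere_sum Sy) enorm_sqr /dot mulr_suml !mulr_sumr -big_split -sumrB.
apply: sumr_ge0 => k _ /=.
have -> : phi ord0 k ^+ 2 / a + a * y ord0 k ^+ 2 - 2 * (phi ord0 k * y ord0 k)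
    = (phi ord0 k - a * y ord0 k) ^+ 2 / a by field; rewrite gt_eqF.
by rewrite divr_ge0 ?sqr_ge0// ltW.
Qed.

Lemma ell_gt0 y : sphere y -> 0 < ell y.
Proof. by have [m m0 H] := ell_lower => /H; exact: lt_le_trans. Qed.

Let lam y := (ell y)^-1.

Lemma measurable_ell : measurable_fun setT ell.
Proof.
apply: measurable_funB => //; apply: measurable_funM => //.
by apply: measurable_sum => k; apply: measurable_funM => //; exact: measurable_rV_coord.
Qed.

Lemma givens_derive_ell i j : i != j -> givens_derive i j ell
  (fun y => -2 * (phi ord0 j * y ord0 i - phi ord0 i * y ord0 j)).
Proof.
move=> ij; have H := givens_deriveD (givens_derive_cst i j (1 + enorm phi ^+ 2))
  (givens_deriveM (givens_derive_cst i j (-2)) (givens_derive_dot ij phi)).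
by apply: (givens_derive_eq H) => y; rewrite /ell; ring.
Qed.

Lemma tame_lam i j : i != j -> tame i j lam.
Proof.
move=> ij; have [m m0 H] := ell_lower.
exact: (tameV ij m0 H measurable_ell (givens_derive_ell ij)).
Qed.

(* h is orthogonal to the density, which is a multiple of ell^(-d) on the sphere. *)
Definition centered (h : 'rV[R]_d.+1 -> R) :=
  [/\ measurable_fun setT h, exists M, forall y, sphere y -> `|h y| <= M
    & (\int[@sphere_measure R d.+1]_(y in sphere (n := d.+1))
        (h y * lam y ^+ d)%:E = 0)%E].

Lemma centered_eq f g : centered f -> measurable_fun setT g ->
  (forall y, sphere y -> f y = g y) -> centered g.
Proof.
move=> [_ [M fM] f0] mg fg; split => //.
  by exists M => y Sy; rewrite -fg// fM.
rewrite -[RHS]f0; apply: eq_integral => y; rewrite inE => Sy.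
by rewrite fg.
Qed.

Lemma integrable_sphere (f : 'rV[R]_d.+1 -> R) M :
  measurable_fun setT f -> (forall y, sphere y -> `|f y| <= M) ->
  (@sphere_measure R d.+1).-integrable (sphere (n := d.+1))
    (fun y => (f y * lam y ^+ d)%:E).
Proof.
move=> mf fM; have [m m0 lm] := ell_lower.
apply: (@measurable_bounded_integrable _ _ _ _ (fun y => f y * lam y ^+ d)).
- exact: measurable_sphere.
- apply: le_lt_trans (sphere_measure_fin R d.+1); apply: le_measure => //;
    by rewrite inE//; exact: measurable_sphere.
- apply: measurable_funTS; apply: measurable_funM => //; apply: measurable_funX.
  by apply: measurable_invr; exact: measurable_ell.
- exists (M * m^-1 ^+ d); split; first exact: num_real.
  move=> N MN y Sy; apply: le_trans (ltW MN).
  have l0 := ell_gt0 Sy.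
  rewrite normrM ler_pM//; first exact: fM.
  rewrite normrX ger0_norm ?invr_ge0 ?(ltW l0)//.
  by rewrite lerXn2r ?nnegrE ?invr_ge0 ?(ltW l0) ?(ltW m0)// lef_pV2 ?posrE// lm.
Qed.

Lemma centeredD f g : centered f -> centered g -> centered (fun y => f y + g y).
Proof.
move=> [mf [M fM] f0] [mg [N gN] g0]; split.
- exact: measurable_funD.
- exists (M + N) => y Sy; rewrite (le_trans (ler_normD _ _))// lerD//;
    [exact: fM|exact: gN].
- under eq_integral do rewrite mulrDl EFinD.
  rewrite integralD//=; first by rewrite f0 g0 adde0.
  + exact: measurable_sphere.
  + exact: integrable_sphere mf fM.
  + exact: integrable_sphere mg gN.
Qed.

Lemma centeredZ c f : centered f -> centered (fun y => c * f y).
Proof.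
move=> [mf [M fM] f0]; split.
- exact: measurable_funM.
- by exists (`|c| * M) => y Sy; rewrite normrM ler_wpM2l// fM.
- under eq_integral do rewrite -mulrA EFinM.
  rewrite integralZl//=; first by rewrite f0 mule0.
  + exact: measurable_sphere.
  + exact: integrable_sphere mf fM.
Qed.

Lemma centered0 : centered (fun=> 0).
Proof.
split => //; first by exists 0 => y _; rewrite normr0.
by rewrite integral0_eq// => y _; rewrite mul0r.
Qed.

Lemma centered_sum (I : Type) (s : seq I) (P : pred I) (F : I -> 'rV[R]_d.+1 -> R) :
  (forall i, P i -> centered (F i)) -> centered (fun y => \sum_(i <- s | P i) F i y).
Proof.
move=> cF; elim: s => [|i s IH].
  by under eq_fun do rewrite big_nil; exact: centered0.
under eq_fun do rewrite big_cons.
case: (boolP (P i)) => Pi //; apply: centeredD => //; exact: cF.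
Qed.

Section stokes.
Variables (j : 'I_d.+1) (b : R) (be : 'rV[R]_d.+1) (e : nat).

Let w (y : 'rV[R]_d.+1) := b + dot be y.

(** The derivative of z_i w ell^(-d-e) along z_i d_j - z_j d_i, without the factor ell^(-d). The
    three summands come from differentiating z_i, w and the power of ell. *)
Let stokes_term (i : 'I_d.+1) (z : 'rV[R]_d.+1) : R := - z ord0 j * w z * lam z ^+ e
  + z ord0 i * (be ord0 j * z ord0 i - be ord0 i * z ord0 j) * lam z ^+ e
  + 2 * (d + e)%:R * (z ord0 i * (phi ord0 j * z ord0 i - phi ord0 i * z ord0 j))
    * w z * lam z ^+ e.+1.

Let centered_stokes_term i : i != j -> centered (stokes_term i).
Proof.
move=> ij.
have tl := tame_lam ij; have tc := @tame_coord R _ _ _ ij.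
have tw : tame i j w by apply: tameD; [exact: tame_cst|exact: tame_dot].
have tJ (be' : 'rV[R]_d.+1) : tame i j (fun z =>
    z ord0 i * (be' ord0 j * z ord0 i - be' ord0 i * z ord0 j)).
  apply: tameM => //; under eq_fun do rewrite -mulNr.
  by apply: tameD; apply: tameM => //; exact: tame_cst.
have tt : tame i j (stokes_term i).
  apply: tameD; first apply: tameD.
  - apply: tameM; last exact: tameX.
    apply: tameM => //; under eq_fun do rewrite -mulN1r.
    by apply: tameM => //; exact: tame_cst.
  - by apply: tameM; last exact: tameX.
  - apply: tameM; last exact: tameX.
    by apply: tameM => //; apply: tameM => //; exact: tame_cst.
case: (tt) => mt bt _; split => //.
have dw := givens_deriveD (givens_derive_cst i j b) (givens_derive_dot ij be).
have l0 y : sphere y -> ell y != 0 by move=> Sy; rewrite gt_eqF// ell_gt0.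
have dl := givens_deriveX (d + e) (givens_deriveV ij (givens_derive_ell ij) l0).
have H := givens_deriveM (givens_deriveM (givens_derive_coord ij i) dw) dl.
have {}H : givens_derive i j (fun y => y ord0 i * w y * lam y ^+ (d + e))
   (fun y => stokes_term i y * lam y ^+ d).
  apply: (givens_derive_eq H) => // y; rewrite /stokes_term eqxx (negbTE ij) -/(lam y) /w.
  rewrite [lam y ^+ e.+1]exprS.
  have: lam y ^+ (d + e) = lam y ^+ d * lam y ^+ e by rewrite exprD.
  (* The derivative of the power involves the predecessor of d + e, so exponent 0 is separated; its
     coefficient is then 0. Otherwise the two sides differ by a multiple of lam lam^k - lam^d lam^e,
     which is 0 by [E]. *)
  case: (d + e)%N => [|k] E /=.
    by rewrite E !mul0r; ring.
  rewrite E; rewrite exprS in E.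
  apply/eqP; rewrite -subr_eq0; apply/eqP.
  rewrite [LHS](_ : _ = 2 * k.+1%:R * y ord0 i
    * (phi ord0 j * y ord0 i - phi ord0 i * y ord0 j) * (b + dot be y) * lam y
    * (lam y * lam y ^+ k - lam y ^+ d * lam y ^+ e)); last by ring.
  by rewrite E subrr mulr0.
apply: (sphere_integral_givens_derive0 ij H).
by apply: tameM => //; exact: tameX.
Qed.

(* sum_(i != j) (z_i d_j - z_j d_i)(z_i w ell^(-d-e)) on the sphere, without the
   factor ell^(-d). *)
Definition stokes (z : 'rV[R]_d.+1) : R := - d%:R * z ord0 j * w z * lam z ^+ e
  + (be ord0 j - z ord0 j * dot be z) * lam z ^+ e
  + 2 * (d + e)%:R * (phi ord0 j - z ord0 j * dot phi z) * w z * lam z ^+ e.+1.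

(** The term i = j is 0, so the sum may run over all i, and then |z| = 1 evaluates it. *)
Let sum_term (c : 'rV[R]_d.+1) z : sphere z ->
  \sum_(i | i != j) z ord0 i * (c ord0 j * z ord0 i - c ord0 i * z ord0 j) =
  c ord0 j - z ord0 j * dot c z.
Proof.
move=> Sz.
transitivity (\sum_i z ord0 i * (c ord0 j * z ord0 i - c ord0 i * z ord0 j)).
  by rewrite [RHS](bigD1 j)//= subrr mulr0 add0r.
transitivity (c ord0 j * 1 - z ord0 j * dot c z); last by rewrite mulr1.
rewrite -[X in c ord0 j * X](sphere_sum Sz) /dot !mulr_sumr -sumrB.
by apply: eq_bigr => k _; ring.
Qed.

Lemma centered_stokes : centered stokes.
Proof.
have H := centered_sum (index_enum _) centered_stokes_term.
apply: (centered_eq H).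
  have mc k : measurable_fun setT (fun z : 'rV[R]_d.+1 => z ord0 k) by exact: measurable_rV_coord.
  have md c : measurable_fun setT (@dot R d.+1 c).
    by apply: measurable_sum => k; apply: measurable_funM.
  have ml k : measurable_fun setT (fun z => lam z ^+ k).
    by apply: measurable_funX; apply: measurable_invr; exact: measurable_ell.
  have mw : measurable_fun setT w by exact: measurable_funD.
  by do ?[exact: mc | exact: md | exact: ml | exact: mw | apply: measurable_funB |
    apply: measurable_funD | apply: measurable_funM | exact: measurable_cst].
move=> z Sz; rewrite /stokes_term !big_split /=; congr (_ + _ + _).
(* Among the d + 1 indices, d differ from j. *)
- rewrite sumr_const cardC1 card_ord -mulr_natl; ring.
- by rewrite -mulr_suml sum_term.
- by rewrite -2!mulr_suml -mulr_sumr sum_term//; ring.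
Qed.

End stokes.
End centered.

(** * Solving the relations for the moments *)

Section moments.
Variables (R : realType) (d : nat) (phi : 'rV[R]_d.+1).
Hypotheses (hphi : enorm phi < 1) (hd : (0 < d)%N).

Let lam y := (ell phi y)^-1.
Let s : R := enorm phi ^+ 2.
Let N : R := d%:R.

(** The mean under the probability proportional to ell^(-d). Stating it as a vanishing integral
    keeps the normalising constant out of all computations. *)
Definition has_mean (h : 'rV[R]_d.+1 -> R) (c : R) :=
  centered phi (fun y => h y - c).

Lemma has_mean_eq f g a b : has_mean f a -> measurable_fun setT g ->
  (forall y, sphere y -> g y = f y) -> b = a -> has_mean g b.
Proof.
move=> mf mg fg ->; apply: (centered_eq mf); first exact: measurable_funB.
by move=> y Sy; rewrite fg.
Qed.

Lemma has_meanD f g a b : has_mean f a -> has_mean g b ->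
  has_mean (fun y => f y + g y) (a + b).
Proof.
move=> fa gb; have H := centeredD hphi fa gb.
rewrite /has_mean (_ : (fun _ => _) = fun y => f y - a + (g y - b))//.
by apply/funext => y; ring.
Qed.

Lemma has_meanZ c f a : has_mean f a -> has_mean (fun y => c * f y) (c * a).
Proof.
move=> fa; have H := centeredZ hphi c fa.
rewrite /has_mean (_ : (fun _ => _) = fun y => c * (f y - a))//.
by apply/funext => y; rewrite mulrBr.
Qed.

Lemma has_mean_cst c : has_mean (fun=> c) c.
Proof.
rewrite /has_mean (_ : (fun _ => _) = fun=> 0); first exact: centered0.
by apply/funext => y; rewrite subrr.
Qed.

Lemma has_mean0 f : centered phi f -> has_mean f 0.
Proof.
by rewrite /has_mean; under [X in _ -> centered _ X]eq_fun do rewrite subr0.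
Qed.

Let s1 : 1 - s != 0.
Proof. by rewrite subr_eq0 eq_sym lt_eqF// enorm_sqr_lt1. Qed.

Let s2 : 1 + s != 0.
Proof. by rewrite gt_eqF// ltr_wpDr// sqr_ge0. Qed.

Let N0 : N != 0. Proof. by rewrite pnatr_eq0 -lt0n. Qed.

Let N1 : N + 1 != 0. Proof. by rewrite natr1 pnatr_eq0. Qed.

Let dot_phi y : dot phi y = (1 + s - ell phi y) / 2.
Proof. by rewrite /ell -/s; field. Qed.

Let dot0 y : dot (0 : 'rV[R]_d.+1) y = 0.
Proof. by rewrite /dot big1// => k _; rewrite mxE mul0r. Qed.

Let dot_delta m (y : 'rV[R]_d.+1) : dot (delta_mx ord0 m) y = y ord0 m.
Proof.
rewrite /dot (bigD1 m)//= mxE !eqxx mul1r big1 ?addr0// => k /negbTE km.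
by rewrite mxE km andbF mul0r.
Qed.

Let ell0 y : sphere y -> ell phi y != 0.
Proof. by move=> Sy; rewrite gt_eqF// ell_gt0. Qed.

Let mc k : measurable_fun setT (fun z : 'rV[R]_d.+1 => z ord0 k).
Proof. exact: measurable_rV_coord. Qed.

Let ml : measurable_fun setT lam.
Proof. by apply: measurable_invr; exact: measurable_ell. Qed.

Ltac side := repeat (apply/andP; split);
  first [exact: s1 | exact: s2 | exact: N0 | exact: N1 | exact: ell0].

Ltac meas := by repeat first [exact: mc | exact: ml | apply: measurable_funB |
  apply: measurable_funD | apply: measurable_funX | apply: measurable_funM |
  exact: measurable_cst].

(** The relations to be solved: [X3] and [X2] take w = 1 with e = 0 and e = 1, [X1] takes w = y_m
    with e = 1, and [X5], [X4] contract [X3], [X2] with [phi]. *)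
Let X3 j : has_mean (stokes phi j 1 0 0) 0.
Proof. by apply: has_mean0; exact: centered_stokes. Qed.

Let X2 j : has_mean (stokes phi j 1 0 1) 0.
Proof. by apply: has_mean0; exact: centered_stokes. Qed.

Let X1 j m : has_mean (stokes phi j 0 (delta_mx ord0 m) 1) 0.
Proof. by apply: has_mean0; exact: centered_stokes. Qed.

Let X5 : has_mean (fun y => \sum_j phi ord0 j * stokes phi j 1 0 0 y) 0.
Proof.
apply: has_mean0; apply: centered_sum => // j _; apply: centeredZ => //.
exact: centered_stokes.
Qed.

Let X4 : has_mean (fun y => \sum_j phi ord0 j * stokes phi j 1 0 1 y) 0.
Proof.
apply: has_mean0; apply: centered_sum => // j _; apply: centeredZ => //.
exact: centered_stokes.
Qed.

(** Replacing phi.y by (1 + s - ell) / 2 lowers the power of [lam] in one part of the last summand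
    of [stokes]; here that part cancels the first summand. *)
Let X3E j y : sphere y -> stokes phi j 1 0 0 y =
  N * (2 * phi ord0 j - (1 + s) * y ord0 j) * lam y.
Proof.
move=> Sy; rewrite /stokes dot_phi dot0 mxE addn0 -/N -/(lam y) /lam.
by field; exact: ell0.
Qed.

Let X2E j y : sphere y -> stokes phi j 1 0 1 y =
  y ord0 j * lam y + (N + 1) * (2 * phi ord0 j - (1 + s) * y ord0 j) * lam y ^+ 2.
Proof.
move=> Sy; rewrite /stokes dot_phi dot0 mxE natrD -/N /lam.
by field; exact: ell0.
Qed.

Let X1E j m y : sphere y -> stokes phi j 0 (delta_mx ord0 m) 1 y =
  (j == m)%:R * lam y
  + (N + 1) * (2 * phi ord0 j - (1 + s) * y ord0 j) * y ord0 m * lam y ^+ 2.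
Proof.
move=> Sy; rewrite /stokes dot_phi dot_delta mxE natrD -/N /lam eqxx /=.
by field; exact: ell0.
Qed.

Let sum_phi (y : 'rV[R]_d.+1) (a b c : R) :
  \sum_j phi ord0 j * (a * phi ord0 j + b * y ord0 j) = a * s + b * dot phi y.
Proof.
rewrite /s enorm_sqr /dot !mulr_sumr -big_split; apply: eq_bigr => k _ /=; ring.
Qed.

(** On the sphere the contraction [X5] equals (N / 2) ((1 + s) - (1 - s)^2 lam). *)
Lemma mean_lam : has_mean lam ((1 + s) / (1 - s) ^+ 2).
Proof.
have H := has_meanD (has_meanZ (- 2 / (N * (1 - s) ^+ 2)) X5)
  (has_mean_cst ((1 + s) / (1 - s) ^+ 2)).
apply: (has_mean_eq H) => [//|y Sy|]; last by rewrite mulr0 add0r.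
rewrite (eq_bigr (fun j => phi ord0 j *
  ((2 * N * lam y) * phi ord0 j + (- N * (1 + s) * lam y) * y ord0 j))); last first.
  by move=> j _; rewrite X3E//; ring.
rewrite sum_phi// dot_phi /lam; field; side.
Qed.

(** By [X3], the mean of (1 + s) y_j lam is that of 2 phi_j lam. *)
Lemma mean_coord_lam j : has_mean (fun y => y ord0 j * lam y)
  (2 * phi ord0 j / (1 - s) ^+ 2).
Proof.
have H := has_meanD (has_meanZ (2 * phi ord0 j / (1 + s)) mean_lam)
  (has_meanZ (- (N * (1 + s))^-1) (X3 j)).
apply: (has_mean_eq H) => [|y Sy|]; first by meas.
  by rewrite X3E//; field; side.
by field; side.
Qed.

(** The value forced by [X4]: on the sphere, twice that contraction equals (N + 2) (1 + s) lam - 1 -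
    (N + 1) (1 - s)^2 lam^2. *)
Let A2 := ((1 + s) ^+ 2 * (N + 2) / (1 - s) ^+ 2 - 1) / ((N + 1) * (1 - s) ^+ 2).

Lemma mean_lam2 : has_mean (fun y => lam y ^+ 2) A2.
Proof.
pose c := ((N + 1) * (1 - s) ^+ 2)^-1.
have H := has_meanD (has_meanD (has_meanZ (c * (1 + s) * (N + 2)) mean_lam)
  (has_mean_cst (- c))) (has_meanZ (- 2 * c) X4).
apply: (has_mean_eq H) => [|y Sy|]; first by meas.
  rewrite (eq_bigr (fun j => phi ord0 j *
    ((2 * (N + 1) * lam y ^+ 2) * phi ord0 j
     + (lam y - (N + 1) * (1 + s) * lam y ^+ 2) * y ord0 j))); last first.
    by move=> j _; rewrite X2E//; ring.
  rewrite sum_phi// dot_phi /c /lam; field; side.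
by rewrite /A2 /c; field; side.
Qed.

(** Solves [X2] for the mean of y_j lam^2, given those of y_j lam and lam^2. *)
Let V2 j := (2 * phi ord0 j / (1 - s) ^+ 2 + 2 * (N + 1) * phi ord0 j * A2)
  / ((N + 1) * (1 + s)).

Lemma mean_coord_lam2 j : has_mean (fun y => y ord0 j * lam y ^+ 2) (V2 j).
Proof.
pose c := ((N + 1) * (1 + s))^-1.
have H := has_meanD (has_meanD (has_meanZ c (mean_coord_lam j))
  (has_meanZ (c * 2 * (N + 1) * phi ord0 j) mean_lam2)) (has_meanZ (- c) (X2 j)).
apply: (has_mean_eq H) => [|y Sy|]; first by meas.
  by rewrite X2E// /c; field; side.
by rewrite /V2 /c /A2; field; side.
Qed.

(** Solves [X1], in which the second moment is the only mean still unknown. *)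
Lemma mean_coord2_lam2 j m : has_mean (fun y => y ord0 j * y ord0 m * lam y ^+ 2)
  (((j == m)%:R * ((1 + s) / (1 - s) ^+ 2) + 2 * (N + 1) * phi ord0 j * V2 m)
   / ((N + 1) * (1 + s))).
Proof.
pose c := ((N + 1) * (1 + s))^-1.
have H := has_meanD (has_meanD (has_meanZ (c * (j == m)%:R) mean_lam)
  (has_meanZ (c * 2 * (N + 1) * phi ord0 j) (mean_coord_lam2 m)))
  (has_meanZ (- c) (X1 j m)).
apply: (has_mean_eq H) => [|y Sy|]; first by meas.
  by rewrite X1E// /c; field; side.
by rewrite /c; field; side.
Qed.

(** For [y] on the sphere, an entry of minus the Hessian at [phi] of the log-density. *)
Definition information (j m : 'I_d.+1) (y : 'rV[R]_d.+1) : R :=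
  d%:R * (2 * (j == m)%:R / (1 - enorm phi ^+ 2)
    + 4 * phi ord0 j * phi ord0 m / (1 - enorm phi ^+ 2) ^+ 2
    + 2 * (j == m)%:R * (ell phi y)^-1
    - 4 * (y ord0 j - phi ord0 j) * (y ord0 m - phi ord0 m) * (ell phi y)^-1 ^+ 2).

(** Expanding the product of the centred coordinates leaves only the moments above; the terms in
    phi_j phi_m cancel and a multiple of the identity remains. *)
Lemma mean_information j m : has_mean (information j m)
  (4 / (1 - enorm phi ^+ 2) ^+ 2 * (d%:R ^+ 2 / d.+1%:R) * (j == m)%:R).
Proof.
have H := has_meanD (has_meanD (has_meanD (has_meanD (has_meanD
  (has_mean_cst (N * (2 * (j == m)%:R / (1 - s)
      + 4 * phi ord0 j * phi ord0 m / (1 - s) ^+ 2)))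
  (has_meanZ (N * 2 * (j == m)%:R) mean_lam))
  (has_meanZ (- 4 * N) (mean_coord2_lam2 j m)))
  (has_meanZ (4 * N * phi ord0 j) (mean_coord_lam2 m)))
  (has_meanZ (4 * N * phi ord0 m) (mean_coord_lam2 j)))
  (has_meanZ (- 4 * N * phi ord0 j * phi ord0 m) mean_lam2).
apply: (has_mean_eq H) => [|y Sy|].
- rewrite /information -/s -/(lam _).
  under eq_fun do rewrite -/(lam _). meas.
- by rewrite /information -/s -/(lam _) -/N; ring.
- rewrite -[d.+1%:R]natr1 -/N -/s /V2 /A2.
  by have [->|_] /= := eqVneq j m; field; side.
Qed.

End moments.

(** * Hessian of the log-likelihood *)

Section real_derivatives.
Variable R : realType.
Implicit Types f g : R -> R.

(** These rules, stated at 0 for explicit functions, are composed as terms below; the resulting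
    derivative is then brought to the announced form by [ring] or [field]. *)
Let dcst (c : R) : is_derive (0 : R) 1 (fun=> c) 0.
Proof. exact: is_derive_cst. Qed.

Let did : is_derive (0 : R) 1 (fun h => h) 1.
Proof. exact: is_derive_id. Qed.

Let dD f g a b : is_derive (0 : R) 1 f a -> is_derive (0 : R) 1 g b ->
  is_derive (0 : R) 1 (fun h => f h + g h) (a + b).
Proof. exact: is_deriveD. Qed.

Let dN f a : is_derive (0 : R) 1 f a -> is_derive (0 : R) 1 (fun h => - f h) (- a).
Proof. exact: is_deriveN. Qed.

Let dM f g a b : is_derive (0 : R) 1 f a -> is_derive (0 : R) 1 g b ->
  is_derive (0 : R) 1 (fun h => f h * g h) (f 0 * b + g 0 * a).
Proof. exact: is_deriveM. Qed.

Let dX2 f a : is_derive (0 : R) 1 f a -> is_derive (0 : R) 1 (fun h => f h ^+ 2) (2 * f 0 * a).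
Proof.
move=> df; have := dM df df; rewrite -mulrDl -mulr2n mulr_natl.
by under [X in is_derive _ _ X _ -> _]eq_fun do rewrite -expr2.
Qed.

Let dV f a : f 0 != 0 -> is_derive (0 : R) 1 f a ->
  is_derive (0 : R) 1 (fun h => (f h)^-1) (- (f 0) ^- 2 * a).
Proof. exact: is_deriveV. Qed.

Let dln f a : 0 < f 0 -> is_derive (0 : R) 1 f a ->
  is_derive (0 : R) 1 (fun h => ln (f h)) ((f 0)^-1 * a).
Proof. by move=> f0 df; exact: (is_derive1_comp (is_derive1_ln f0)). Qed.

Let dA (a u : R) : is_derive (0 : R) 1 (fun h => a - (2 * h * u + h ^+ 2)) (- 2 * u).
Proof.
have [H1 H2] := dD (dcst a) (dN (dD (dM (dM (dcst 2) did) (dcst u)) (dX2 did))).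
by apply: DeriveDef; rewrite ?H2//; ring.
Qed.

Let dB (b w : R) : is_derive (0 : R) 1 (fun h => b - 2 * h * w + h ^+ 2) (- 2 * w).
Proof.
have [H1 H2] := dD (dD (dcst b) (dN (dM (dM (dcst 2) did) (dcst w)))) (dX2 did).
by apply: DeriveDef; rewrite ?H2//; ring.
Qed.

Let A0 (a u : R) : a - (2 * 0 * u + 0 ^+ 2) = a. Proof. ring. Qed.

Let B0 (b w : R) : b - 2 * 0 * w + 0 ^+ 2 = b. Proof. ring. Qed.

(** The log-density on the line through z in direction j: a = 1 - |z|^2, b = |z - y|^2, u = z_j and
    w = y_j - z_j. *)
Lemma is_derive_ln_ratio (K D a b u w : R) : 0 < a -> 0 < b ->
  is_derive (0 : R) 1 (fun h : R => K + D * (ln (a - (2 * h * u + h ^+ 2))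
    - ln (b - 2 * h * w + h ^+ 2))) (D * (- 2 * u / a + 2 * w / b)).
Proof.
move=> a0 b0.
have a0' : 0 < a - (2 * 0 * u + 0 ^+ 2) by rewrite A0.
have b0' : 0 < b - 2 * 0 * w + 0 ^+ 2 by rewrite B0.
have [H1 H2] := dD (dcst K) (dM (dcst D)
  (dD (dln a0' (dA a u)) (dN (dln b0' (dB b w))))).
apply: DeriveDef => //; rewrite H2 /= A0 B0.
by field; rewrite !gt_eqF.
Qed.

(** The j-th partial derivative of the log-density on the line through phi in direction i: u, w
    belong to j and u', w' to i, while r is the Kronecker delta of i and j. *)
Lemma is_derive_ratio (D a b u u' w w' r : R) : a != 0 -> b != 0 ->
  is_derive (0 : R) 1 (fun h : R => D * (- 2 * (u + h * r) / (a - (2 * h * u' + h ^+ 2))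
    + 2 * (w - h * r) / (b - 2 * h * w' + h ^+ 2)))
   (D * (- 2 * r / a - 4 * u * u' / a ^+ 2 - 2 * r / b + 4 * w * w' / b ^+ 2)).
Proof.
move=> a0 b0.
have a0' : a - (2 * 0 * u' + 0 ^+ 2) != 0 by rewrite A0.
have b0' : b - 2 * 0 * w' + 0 ^+ 2 != 0 by rewrite B0.
have dr := dM did (dcst r).
have [H1 H2] := dM (dcst D) (dD
  (dM (dM (dcst (- 2)) (dD (dcst u) dr)) (dV a0' (dA a u')))
  (dM (dM (dcst 2) (dD (dcst w) (dN dr))) (dV b0' (dB b w')))).
apply: DeriveDef => //; rewrite H2 /= A0 B0.
by field; rewrite a0 b0.
Qed.

End real_derivatives.

Lemma is_derive_line (R : realType) (V : normedModType R) (f : V -> R) (x v : V) df :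
  is_derive (0 : R) 1 (fun h : R => f (h *: v + x)) df -> is_derive x v f df.
Proof.
move=> [dfx dfE]; apply: DeriveDef; first exact/derivable1P.
rewrite -dfE /derive; set g1 := fun h => h^-1 *: _; set g2 := fun h => h^-1 *: _.
suff -> : g1 = g2 by [].
by apply/funext => h; rewrite /g1 /g2 /=; rewrite addr0 scale0r add0r [_%:A]mulr1.
Qed.

Lemma enorm_sqr_line (R : realType) n (x : 'rV[R]_n) j (h : R) :
  enorm (h *: delta_mx ord0 j + x) ^+ 2 =
  enorm x ^+ 2 + (2 * h * x ord0 j + h ^+ 2).
Proof.
rewrite !enorm_sqr [LHS](bigD1 j)//= [in RHS](bigD1 j)//= !mxE !eqxx mulr1.
rewrite (eq_bigr (fun k => x ord0 k ^+ 2)); first by ring.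
by move=> k /negbTE kj; rewrite !mxE kj andbF mulr0 add0r.
Qed.

Lemma enorm_sqr_gt0 (R : realType) n (x : 'rV[R]_n) : x != 0 -> 0 < enorm x ^+ 2.
Proof.
move=> x0; rewrite lt_def sqr_ge0 andbT; apply: contra x0 => /eqP.
rewrite enorm_sqr => /psumr_eq0P H; apply/eqP/rowP => k; rewrite mxE.
by apply/eqP; rewrite -sqrf_eq0 H// => i _; exact: sqr_ge0.
Qed.

Lemma continuous_enorm_sqr (R : realType) n (y : 'rV[R]_n.+1) :
  continuous (fun z : 'rV[R]_n.+1 => enorm (z - y) ^+ 2).
Proof.
rewrite (_ : (fun _ => _) = fun z : 'rV[R]_n.+1 =>
    \sum_k (z ord0 k - y ord0 k) ^+ 2); last first.
  by apply/funext => x; rewrite enorm_sqr; apply: eq_bigr => k _; rewrite !mxE.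
elim: (index_enum _) => [|k r IH].
  rewrite (_ : (fun _ => _) = fun=> 0); first by move=> z; exact: cst_continuous.
  by apply/funext => z; rewrite big_nil.
rewrite (_ : (fun _ => _) = fun z : 'rV[R]_n.+1 =>
    (z ord0 k - y ord0 k) ^+ 2 + \sum_(l <- r) (z ord0 l - y ord0 l) ^+ 2); last first.
  by apply/funext => z; rewrite big_cons.
move=> z; apply: (@continuousD _ _ _ (fun z : 'rV[R]_n.+1 => (z ord0 k - y ord0 k) ^+ 2)
  (fun z : 'rV[R]_n.+1 => \sum_(l <- r) (z ord0 l - y ord0 l) ^+ 2)); last exact: IH.
pose c (z : 'rV[R]_n.+1) : R := z ord0 k - y ord0 k.
have cc : {for z, continuous c}.
  by apply: continuousB; [exact: coord_continuous | exact: cst_continuous].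
exact: (continuousM cc cc).
Qed.

Section hessian.
Variables (R : realType) (d : nat) (phi y : 'rV[R]_d.+1).
Hypotheses (hphi : enorm phi < 1) (yphi : y != phi)
  (K0 : 0 < Gamma (d.+1%:R / 2) / (2 * pi `^ (d.+1%:R / 2)) :> R).

Let K : R := Gamma (d.+1%:R / 2) / (2 * pi `^ (d.+1%:R / 2)).

(** An open set of parameters containing [phi] on which the log-density has a smooth closed form.
    Second derivatives at [phi] need the first ones on a neighbourhood. *)
Let U z := enorm z ^+ 2 < 1 /\ z != y.

Let nearU z : U z -> \forall p \near z, U p.
Proof.
move=> [z1 zy].
have near1 : \forall p \near z, enorm (p - 0) ^+ 2 < 1.
  by apply: (cvgr_lt _ (@continuous_enorm_sqr R d 0 z)); rewrite subr0.
have near2 : \forall p \near z, 0 < enorm (p - y) ^+ 2.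
  apply: (cvgr_gt _ (@continuous_enorm_sqr R d y z)).
  by rewrite enorm_sqr_gt0// subr_eq0.
near=> p; split; first by rewrite -[p]subr0; near: p.
suff : enorm (p - y) ^+ 2 != 0.
  by apply: contraNneq => ->; rewrite subrr enorm_sqr big1// => k _; rewrite mxE expr0n.
by rewrite gt_eqF//; near: p.
Unshelve. all: by end_near. Qed.

Let Uphi : U phi.
Proof. by split; [rewrite expr_lt1// sqrtr_ge0|rewrite eq_sym]. Qed.

Let score j (z : 'rV[R]_d.+1) : R := d%:R *
  (- 2 * z ord0 j / (1 - enorm z ^+ 2)
   + 2 * (y ord0 j - z ord0 j) / enorm (z - y) ^+ 2).

Let q_gt0 z : U z -> 0 < enorm (z - y) ^+ 2.
Proof. by move=> [_ zy]; rewrite enorm_sqr_gt0// subr_eq0. Qed.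

Let enormN (x : 'rV[R]_d.+1) : enorm (- x) = enorm x.
Proof. by congr Num.sqrt; apply: eq_bigr => k _; rewrite mxE sqrrN. Qed.

Let log_pdf z : U z -> ln (cauchy_pdf z y) =
  ln K + d%:R * (ln (1 - enorm z ^+ 2) - ln (enorm (z - y) ^+ 2)).
Proof.
move=> Uz; have q0 := q_gt0 Uz; case: Uz => z1 _.
have a0 : 0 < 1 - enorm z ^+ 2 by rewrite subr_gt0.
rewrite /cauchy_pdf gtr0_norm// -[y - z]opprB enormN.
have r0 : 0 < (1 - enorm z ^+ 2) / enorm (z - y) ^+ 2 by rewrite divr_gt0.
rewrite -/K lnM ?posrE ?exprn_gt0//; congr (_ + _).
by rewrite [LHS]lnXn// ln_div ?posrE// mulr_natl.
Qed.

Let is_derive_log_pdf j z : U z ->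
  is_derive z (delta_mx ord0 j) (fun p => ln (cauchy_pdf p y)) (score j z).
Proof.
move=> Uz; pose f (p : 'rV[R]_d.+1) :=
  ln K + d%:R * (ln (1 - enorm p ^+ 2) - ln (enorm (p - y) ^+ 2)).
apply: (@near_eq_is_derive _ _ _ f).
  by near=> p; rewrite log_pdf//; near: p; exact: nearU.
apply: is_derive_line.
rewrite (_ : (fun _ => _) = fun h : R => ln K + d%:R *
  (ln (1 - enorm z ^+ 2 - (2 * h * z ord0 j + h ^+ 2))
   - ln (enorm (z - y) ^+ 2 - 2 * h * (y ord0 j - z ord0 j) + h ^+ 2))).
  apply: is_derive_ln_ratio; last exact: q_gt0.
  by rewrite subr_gt0; case: Uz.
apply/funext => h; rewrite /f -addrA !enorm_sqr_line !mxE.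
by congr (_ + _ * (ln _ - ln _)); ring.
Unshelve. all: by end_near. Qed.

Let partial_log_pdf j z : U z -> partial j (fun p => ln (cauchy_pdf p y)) z = score j z.
Proof. by move=> /(is_derive_log_pdf j) []. Qed.

(** An entry of the Hessian itself, hence opposite in sign to [information]. *)
Let information_at i j : R := d%:R * (- 2 * (i == j)%:R / (1 - enorm phi ^+ 2)
  - 4 * phi ord0 j * phi ord0 i / (1 - enorm phi ^+ 2) ^+ 2
  - 2 * (i == j)%:R / enorm (phi - y) ^+ 2
  + 4 * (y ord0 j - phi ord0 j) * (y ord0 i - phi ord0 i) / (enorm (phi - y) ^+ 2) ^+ 2).

Let is_derive_partial i j : is_derive phi (delta_mx ord0 i)
  (partial j (fun p => ln (cauchy_pdf p y))) (information_at i j).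
Proof.
apply: (@near_eq_is_derive _ _ _ (score j)).
  by near=> p; rewrite partial_log_pdf//; near: p; exact: nearU.
apply: is_derive_line.
rewrite (_ : (fun _ => _) = fun h : R => d%:R *
  (- 2 * (phi ord0 j + h * (i == j)%:R)
     / (1 - enorm phi ^+ 2 - (2 * h * phi ord0 i + h ^+ 2))
   + 2 * ((y ord0 j - phi ord0 j) - h * (i == j)%:R)
     / (enorm (phi - y) ^+ 2 - 2 * h * (y ord0 i - phi ord0 i) + h ^+ 2))).
  apply: is_derive_ratio; last by rewrite gt_eqF// q_gt0.
  by rewrite gt_eqF// subr_gt0; case: Uphi.
apply/funext => h; rewrite /score -addrA !enorm_sqr_line !mxE eqxx/= [j == i]eq_sym.
congr (_ * (_ / _ + _ / _)); ring.
Unshelve. all: by end_near. Qed.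

Lemma has_hessian_log_pdf : has_hessian (fun p => ln (cauchy_pdf p y)) phi.
Proof.
move=> i j; split; last by case: (is_derive_partial i j).
by near=> z; have [|//] := @is_derive_log_pdf j z; near: z; exact: nearU.
Unshelve. all: by end_near. Qed.

Lemma log_likelihood_hessianE i j :
  log_likelihood_hessian phi y i j = information_at i j.
Proof. by rewrite mxE /partial; case: (is_derive_partial i j). Qed.

End hessian.

(** * Expectations under the spherical Cauchy distribution *)

(** A set of [mu]-measure 0 has [nu]-measure 0, so the Radon-Nikodym derivative exists; it has the
    same integrals as [g] over all measurable sets and thus equals [g] almost everywhere. *)
Lemma integral_density d (T : measurableType d) (R : realType)
    (nu : {finite_measure set T -> \bar R}) (mu : {sigma_finite_measure set T -> \bar R})
    (g : T -> R) (f : T -> \bar R) (U : set T) :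
  measurable_fun setT g ->
  (forall A, measurable A -> nu A = (\int[mu]_(x in A) (g x)%:E)%E) ->
  measurable U -> nu.-integrable U f ->
  (\int[nu]_(x in U) f x = \int[mu]_(x in U) (f x * (g x)%:E))%E.
Proof.
move=> mg nug mU intf.
have numu : nu `<< mu.
  apply/null_content_dominatesP => A mA A0.
  rewrite nug// null_set_integral//.
  by apply/measurable_EFinP; exact: measurable_funTS.
rewrite -(Radon_Nikodym_change_of_variables numu)//.
apply: ae_eq_integral => //.
- apply: emeasurable_funM; first exact: measurable_int intf.
  apply: measurable_funTS; apply: (measurable_int mu).
  exact: Radon_Nikodym_integrable.
- apply: emeasurable_funM; first exact: measurable_int intf.
  by apply/measurable_EFinP; exact: measurable_funTS.
- apply: ae_eqe_mul2l; apply: integral_ae_eq => //.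
  + by apply: (integrableS measurableT) => //; exact: Radon_Nikodym_integrable.
  + by apply/measurable_EFinP; exact: measurable_funTS.
  + by move=> E _ mE; rewrite -nug// -Radon_Nikodym_integral.
Qed.

Section spherical_cauchy.
Variables (R : realType) (d : nat) (phi : 'rV[R]_d.+1).
Hypothesis hphi : enorm phi < 1.
Variables (dO : measure_display) (O : measurableType dO) (P : probability O R).
Variables (Y : {RV P >-> 'rV[R]_d.+1}) (hY : spherical_cauchy phi Y).

Let K : R := Gamma (d.+1%:R / 2) / (2 * pi `^ (d.+1%:R / 2)).

Let measurable_pdf : measurable_fun setT (cauchy_pdf phi).
Proof.
apply: measurable_funM => //; apply: measurable_funX; apply: measurable_funM => //.
apply: measurable_invr; apply: measurable_funX.
apply: (measurableT_comp (@measurable_enorm R d.+1)).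
apply/measurable_fun_rVP => k; under eq_fun do rewrite !mxE.
by apply: measurable_funB => //; exact: measurable_rV_coord.
Qed.

(** The Gamma integral is not evaluated: it is nonnegative, and if the constant were 0 the law of
    [Y] would have total mass 0 instead of 1. *)
Lemma cauchy_pdf_const_gt0 : 0 < K.
Proof.
have pi0 : 0 < 2 * pi `^ (d.+1%:R / 2) :> R by rewrite mulr_gt0// powR_gt0 ?pi_gt0.
rewrite lt_def; apply/andP; split; last first.
  rewrite divr_ge0 ?(ltW pi0)//; apply: Rintegral_ge0 => t _.
  by rewrite mulr_ge0 ?powR_ge0 ?expR_ge0.
apply/eqP => K0; have := hY (@measurableT _ _).
rewrite integral0_eq; last by move=> y _; rewrite /cauchy_pdf -/K K0 mul0r.
by rewrite probability_setT => /eqP; rewrite onee_eq0.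
Qed.

Let pd := distribution P Y.

Let mC := measurableC (@measurable_sphere R d.+1).

Let pd_sphereC : pd (~` sphere (n := d.+1)) = 0%E.
Proof.
rewrite /pd (hY mC); apply: (null_set_integral mC _ (sphere_measureC R d.+1)).
by apply/measurable_EFinP; exact: measurable_funTS.
Qed.

Section bounded.
Variables (h : 'rV[R]_d.+1 -> R) (M : R).
Hypotheses (mh : measurable_fun setT h) (hM : forall y, sphere y -> `|h y| <= M).

(** A bound on the sphere suffices because [Y] lies there almost surely. *)
Let pd_integrable : pd.-integrable setT (EFin \o h).
Proof.
apply/integrableP; split; first exact/measurable_EFinP.
apply: (@le_lt_trans _ _ (`|M|%:E * pd setT)%E); last first.
  by rewrite /pd probability_setT mule1 ltry.
apply: integral_le_bound => //; first exact/measurable_EFinP.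
exists (~` sphere (n := d.+1)); split; [exact: mC | exact: pd_sphereC | ].
move=> y /= ny Sy; apply: ny => _.
by rewrite lee_fin (le_trans (hM Sy))// ler_norm.
Qed.

Lemma integrable_bounded : P.-integrable setT (fun w => (h (Y w))%:E).
Proof.
apply/integrableP; split.
  by apply/measurable_EFinP; exact: measurableT_comp.
have /integrableP[_] := pd_integrable.
by rewrite ge0_integral_distribution//; do 2 apply: measurableT_comp => //.
Qed.

(** Pass to the law of [Y], drop the null complement of the sphere and insert the density, which on
    the sphere is a constant times ell^(-d). *)
Lemma integral_bounded : (\int[P]_w (h (Y w))%:E =
  (K * (1 - enorm phi ^+ 2) ^+ d)%:E *
  \int[@sphere_measure R d.+1]_(y in sphere (n := d.+1))
    (h y * (ell phi y)^-1 ^+ d)%:E)%E.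
Proof.
transitivity (\int[pd]_y (h y)%:E)%E.
  rewrite integral_distribution//; last exact: integrable_bounded.
  exact/measurable_EFinP.
rewrite (@negligible_integral _ _ _ pd setT (~` sphere (n := d.+1)) _ mC _ _ pd_sphereC)//.
rewrite setTD setCK (integral_density measurable_pdf hY).
- rewrite -integralZl; last 2 first.
  + exact: measurable_sphere.
  + exact: (integrable_sphere hphi mh hM).
  apply: eq_integral => y; rewrite inE => Sy; rewrite -EFinM -EFinM; congr EFin.
  rewrite /cauchy_pdf -/K -(ellE phi Sy) ger0_norm; last first.
    by rewrite subr_ge0 ltW// enorm_sqr_lt1.
  by rewrite exprMn; ring.
- exact: measurable_sphere.
- by apply: integrableS pd_integrable => //; exact: measurable_sphere.
Qed.

End bounded.

(** The integral of h - c vanishes whatever the constant in front, and c integrates to itself since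
    [P] has mass 1; the normalising constant is thus never computed. *)
Lemma integral_has_mean h c : has_mean phi h c -> measurable_fun setT h ->
  (\int[P]_w (h (Y w))%:E = c%:E)%E.
Proof.
move=> [mhc [M hM] h0] mh.
have I0 := integral_bounded mhc hM; rewrite h0 mule0 in I0.
transitivity (\int[P]_w ((h (Y w) - c)%:E + (cst c w)%:E))%E.
  by apply: eq_integral => w _; rewrite -EFinD subrK.
rewrite integralD//=; last 2 first.
- exact: (integrable_bounded mhc hM).
- exact: finite_measure_integrable_cst.
by rewrite I0 add0e integral_cst// [X in (_ * X)%E]probability_setT mule1.
Qed.

Lemma has_mean_integrable h c : has_mean phi h c -> measurable_fun setT h ->
  P.-integrable setT (fun w => (h (Y w))%:E).
Proof.
move=> [mhc [M hM] _] mh; apply: (@integrable_bounded _ (M + `|c|)) => // y Sy.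
by rewrite -[h y](subrK c) (le_trans (ler_normD _ _))// lerD2r hM.
Qed.

End spherical_cauchy.

(* At y = phi the density is a junk value (division by 0), so this point, which is
   off the sphere, has to be treated apart. *)
Lemma measurable_log_likelihood_hessian (R : realType) d (phi : 'rV[R]_d.+1) i j :
  enorm phi < 1 -> 0 < Gamma (d.+1%:R / 2) / (2 * pi `^ (d.+1%:R / 2)) :> R ->
  measurable_fun setT (fun y => log_likelihood_hessian phi y i j).
Proof.
move=> hphi K0.
have menorm : measurable_fun setT (fun y : 'rV[R]_d.+1 => enorm (phi - y)).
  apply: (measurableT_comp (@measurable_enorm R d.+1)).
  apply/measurable_fun_rVP => k; under eq_fun do rewrite !mxE.
  by apply: measurable_funB => //; exact: measurable_rV_coord.
pose H (y : 'rV[R]_d.+1) : R := d%:R * (- 2 * (i == j)%:R / (1 - enorm phi ^+ 2)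
  - 4 * phi ord0 j * phi ord0 i / (1 - enorm phi ^+ 2) ^+ 2
  - 2 * (i == j)%:R / enorm (phi - y) ^+ 2
  + 4 * (y ord0 j - phi ord0 j) * (y ord0 i - phi ord0 i) / (enorm (phi - y) ^+ 2) ^+ 2).
rewrite (_ : (fun _ => _) = fun y : 'rV[R]_d.+1 => if enorm (phi - y) == 0 then
    log_likelihood_hessian phi phi i j else H y); last first.
  apply/funext => y; have [->|yphi] := eqVneq y phi.
    by rewrite subrr ifT// -sqrf_eq0 enorm_sqr big1// => k _; rewrite mxE expr0n.
  rewrite ifF; first exact: log_likelihood_hessianE.
  by rewrite -sqrf_eq0 gt_eqF// enorm_sqr_gt0// subr_eq0 eq_sym.
have mk k : measurable_fun setT (fun y : 'rV[R]_d.+1 => y ord0 k).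
  exact: measurable_rV_coord.
apply: measurable_fun_ifT => //; first exact: measurable_fun_eqr.
by repeat first [exact: mk | exact: menorm | apply: measurable_invr |
  apply: measurable_funB | apply: measurable_funD | apply: measurable_funX |
  apply: measurable_funM | exact: measurable_cst].
Qed.

Unset Implicit Arguments.
Set Strict Implicit.

Theorem lemma2 (R : realType) (d : nat) (hd : (1 <= d)%N)
    (phi : 'rV[R]_d.+1) (hphi : enorm phi < 1)
    (dO : measure_display) (O : measurableType dO) (P : probability O R)
    (Y : {RV P >-> 'rV[R]_d.+1}) (hY : spherical_cauchy phi Y) :
  [/\ forall y : 'rV[R]_d.+1, sphere y ->
        has_hessian (fun p => ln (cauchy_pdf p y)) phi,
      mx_integrable P (fun w => log_likelihood_hessian phi (Y w))
    & fisher_information phi Y =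
        (4 / (1 - enorm phi ^+ 2) ^+ 2 * (d%:R ^+ 2 / d.+1%:R)) *: 1%:M].
Proof.
have K0 := cauchy_pdf_const_gt0 hY.
have yphi y : sphere y -> y != phi.
  by move=> Sy; apply: contraTneq hphi => <-; rewrite Sy ltxx.
pose c : R := 4 / (1 - enorm phi ^+ 2) ^+ 2 * (d%:R ^+ 2 / d.+1%:R).
have mH i j := measurable_log_likelihood_hessian i j hphi K0.
have mean i j : has_mean phi (fun y => log_likelihood_hessian phi y i j)
    (- (c * (i == j)%:R)).
  (* The factor -1 turns [information] into the Hessian of the log-density. *)
  have H := has_meanZ hphi (-1) (mean_information hphi hd i j).
  apply: (has_mean_eq H) => // [y Sy|]; last by rewrite mulN1r.
  rewrite log_likelihood_hessianE ?yphi// /information ellE//.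
  have -> : enorm (phi - y) = enorm (y - phi).
    by congr Num.sqrt; apply: eq_bigr => k _; rewrite !mxE; ring.
  by rewrite exprVn; ring.
split.
- by move=> y Sy; apply: has_hessian_log_pdf => //; exact: yphi.
- by move=> i j; exact: (has_mean_integrable hY (mean i j) (mH i j)).
- apply/matrixP => i j; rewrite !mxE unlock.
  by rewrite (integral_has_mean hphi hY (mean i j) (mH i j))//= opprK mulr_natr.
Qed.
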